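(* Let $G$ be a second countable locally compact group with right Haar measure $\lambda$, let $a\in G$ be an aperiodic element, and let $\Phi$ be a $\Delta_2$-regular Young function. Let $L\ge 2$, and for $1\le l\le L$ let $w_l$ be a weight on $G$ with $w_l^{-1}\in L^\infty(G)$ and let $T_l=T_{a,w_l}$ be the weighted translation on the Orlicz space $L^\Phi(G)$ generated by $a$ and $w_l$. For $n\in\mathbb{N}$ and $x\in G$ put $$\varphi_{l,n}(x)=\prod_{j=1}^{n}w_l(xa^{j}),\qquad \widetilde{\varphi}_{l,n}(x)=\Big(\prod_{j=0}^{n-1}w_l(xa^{-j})\Big)^{-1}.$$ Let $1\le r_1<r_2<\cdots<r_L$ be integers. Then the following conditions are equivalent. (i) $T_1^{r_1},T_2^{r_2},\dots,T_L^{r_L}$ are disjoint topologically transitive on $L^\Phi(G)$. (ii) For each compact subset $K\subset G$ with $\lambda(K)>0$, there are a sequence of Borel sets $(E_k)$ in $K$ with $\lambda(K)=\lim_{k\to\infty}\lambda(E_k)$ and a strictly increasing sequence $(n_k)$ of positive integers such that, for $1\le l\le L$, $$\lim_{k\to\infty}\big\|\varphi_{l,r_ln_k}|_{E_k}\big\|_\infty=\lim_{k\to\infty}\big\|\widetilde{\varphi}_{l,r_ln_k}|_{E_k}\big\|_\infty=0,$$ and, for $1\le s<l\le L$, $$\lim_{k\to\infty}\left\|\frac{\widetilde{\varphi}_{s,(r_l-r_s)n_k}\cdot\widetilde{\varphi}_{l,r_ln_k}}{\widetilde{\varphi}_{s,r_ln_k}}\Big|_{E_k}\right\|_\infty=\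lim_{k\to\infty}\left\|\frac{\varphi_{l,(r_l-r_s)n_k}\cdot\widetilde{\varphi}_{s,r_sn_k}}{\widetilde{\varphi}_{l,r_sn_k}}\Big|_{E_k}\right\|_\infty=0.$$
   Context: $\mathbb{N}=\{1,2,\dots\}$. A Young function is a continuous, even, convex function $\Phi:\mathbb{R}\to\mathbb{R}$ with $\Phi(0)=0$, $\Phi(t)>0$ for $t>0$, and $\lim_{t\to\infty}\Phi(t)=\infty$. It is $\Delta_2$-regular if there are constants $M>0$ and $t_0>0$ such that $\Phi(2t)\le M\Phi(t)$ for all $t\ge t_0$ when $G$ is compact, and $\Phi(2t)\le M\Phi(t)$ for all $t>0$ when $G$ is noncompact. The Orlicz space $L^\Phi(G)$ is the space of Borel functions $f:G\to\mathbb{C}$ (modulo equality $\lambda$-a.e.) with $\int_G\Phi(\alpha|f|)\,d\lambda<\infty$ for some $\alpha>0$; it is a Banach space under the Luxemburg norm $N_\Phi(f)=\inf\{k>0:\int_G\Phi(|f|/k)\,d\lambda\le1\}$. A weight on $G$ is a bounded continuous function $w:G\to(0,\infty)$; $w^{-1}=1/w$ denotes the pointwise reciprocal. The weighted translation $T_{a,w}:L^\Phi(G)\to L^\Phi(G)$ is $(T_{a,w}f)(x)=w(x)f(xa^{-1})$. An element $a\in G$ is aperiodic if the closed subgroup of $G$ generated by $a$ is not compact. Operators $A_1,\dots,A_L$ ($L\ge2$) on a separable Banach space $X$ are disjoint topologically transitive if for all nonempty open sets $U,V_1,\dots,V_L\subset X$ there is $n\in\mathbb{N}$ with $U\cap A_1^{-n}(V_1)\cap\cdots\cap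 A_L^{-n}(V_L)\ne\emptyset$, where $A^{-n}(V)$ denotes the preimage of $V$ under $A^n$. *)

(* Defs.v *)
From HB Require Import structures.
From mathcomp Require Import all_boot all_order all_algebra.
From mathcomp Require Import all_classical all_reals all_analysis.
From mathcomp Require Import measurable_realfun complex.
From mathcomp Require Import ring lra.
Import Order.TTheory GRing.Theory Num.Theory Normc.
Import numFieldNormedType.Exports.

Set Implicit Arguments.
Unset Strict Implicit.
Unset Printing Implicit Defensive.

Local Open Scope classical_set_scope.
Local Open Scope complex_scope.
Local Open Scope quotient_scope.
Local Open Scope ring_scope.

Definition borel (T : ptopologicalType) := g_sigma_algebraType (@open T).

Lemma borel_open (T : ptopologicalType) (U : set T) :
  open U -> measurable (U : set (borel T)).
Proof. by move=> oU; exact: sub_sigma_algebra. Qed.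

Lemma borel_continuous (S T : ptopologicalType) (f : S -> T) :
  continuous f -> measurable_fun [set: borel S] (f : borel S -> borel T).
Proof.
move=> /continuousP cf; apply: (@measurability _ _ _ (borel T) _ _ (@open T)) => //.
by move=> _ [U oU <-]; rewrite setTI; apply: borel_open; exact: cf.
Qed.

Lemma borel_continuous_real (R : realType) (S : ptopologicalType) (f : S -> R) :
  continuous f -> measurable_fun [set: borel S] (f : borel S -> R).
Proof.
move=> /continuousP cf; apply: (measurability _ (RGenOpens.measurableE R)) => //.
move=> _ [U [a [b ->]] <-]; rewrite setTI; apply: borel_open.
by apply: cf; exact: interval_open.
Qed.

Section complex_borel.
Context {R : realType}.
Local Notation C := (R[i]^o).

Lemma normc_ge0 (z : R[i]) : 0 <= normc z.
Proof. by case: z => x y; exact: sqrtr_ge0. Qed.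

Lemma norm_normc (z : R[i]) : `|z| = (normc z)%:C.
Proof. by case: z. Qed.

Lemma normc_real (x : R) : normc x%:C = `|x|.
Proof. by rewrite /normc /= expr0n /= addr0 sqrtr_sqr. Qed.

Lemma normcRe (z : R[i]) : `|complex.Re z| <= normc z.
Proof.
case: z => x y /=; rewrite -sqrtr_sqr ler_wsqrtr//.
by rewrite lerDl sqr_ge0.
Qed.

Lemma normcIm (z : R[i]) : `|complex.Im z| <= normc z.
Proof.
case: z => x y /=; rewrite -sqrtr_sqr ler_wsqrtr//.
by rewrite lerDr sqr_ge0.
Qed.

Lemma normc_le_ReIm (z : R[i]) :
  normc z <= `|complex.Re z| + `|complex.Im z|.
Proof.
case: z => x y /=; rewrite -(ger0_norm (addr_ge0 (normr_ge0 x) (normr_ge0 y))).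
rewrite -sqrtr_sqr ler_wsqrtr// sqrrD !real_normK ?num_real//.
rewrite addrAC lerDl mulrn_wge0// mulr_ge0//.
Qed.

Lemma continuous_complex_lip (f : C -> R) :
  (forall x y, `|f x - f y| <= normc (x - y)) -> continuous f.
Proof.
move=> lf x; apply/(@cvgrPdist_lt _ _ C (nbhs x) (nbhs_filter x)) => e e0.
apply/nbhs_ballP; exists e%:C => /=; first by rewrite ltcR.
by move=> y; rewrite /ball /= norm_normc ltcR; apply: le_lt_trans; exact: lf.
Qed.

Lemma continuous_Re : continuous (@complex.Re R : C -> R).
Proof. by apply: continuous_complex_lip => x y; rewrite -raddfB; exact: normcRe. Qed.

Lemma continuous_Im : continuous (@complex.Im R : C -> R).
Proof. by apply: continuous_complex_lip => x y; rewrite -raddfB; exact: normcIm. Qed.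

Lemma continuous_normc : continuous (@normc R : C -> R).
Proof.
apply: continuous_complex_lip => x y.
by rewrite -lecR -normc_real -!norm_normc rmorphB /= -!norm_normc ler_dist_dist.
Qed.

Lemma measurable_complexP d (T : measurableType d) (f : T -> C) :
  measurable_fun [set: T] (f : T -> borel C) <->
  measurable_fun [set: T] (fun x => complex.Re (f x)) /\
  measurable_fun [set: T] (fun x => complex.Im (f x)).
Proof.
split=> [mf|[mre mim]].
  split; apply: (measurableT_comp _ mf); apply: borel_continuous_real.
    exact: continuous_Re.
  exact: continuous_Im.
apply: (@measurability _ _ _ (borel C) _ _ (@open C)) => //.
move=> _ [U oU <-]; rewrite setTI.
pose B (q : rat * rat * rat) : set C :=
  [set z | `|complex.Re z - ratr q.1.1| < ratr q.2 /\
           `|complex.Im z - ratr q.1.2| < ratr q.2].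
pose V (q : rat * rat * rat) : set C := if `[< B q `<=` U >] then B q else set0.
have -> : f @^-1` U = \bigcup_q (f @^-1` V q).
  apply/seteqP; split=> [x Ufx|x [q _]]; last first.
    by rewrite /= /V; case: asboolP => // /[apply].
  have /nbhs_ballP[e /= e0 eU] : nbhs (f x) U by exact: open_nbhs_nbhs.
  have : 0 < complex.Re e by move: e0; rewrite ltcE /= => /andP[].
  set r := complex.Re e => r0.
  have re : r%:C = e by rewrite RRe_real// gtr0_real.
  have r4 : 0 < r / 4 by rewrite divr_gt0.
  have [q] := rat_in_itvoo r4; rewrite in_itv /= => /andP[q0 qr].
  have [p] : exists p, ratr p \in `]complex.Re (f x), complex.Re (f x) + ratr q[.
    by apply: rat_in_itvoo; rewrite ltrDl.
  rewrite in_itv /= => /andP[p1 p2].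
  have [s] : exists s, ratr s \in `]complex.Im (f x), complex.Im (f x) + ratr q[.
    by apply: rat_in_itvoo; rewrite ltrDl.
  rewrite in_itv /= => /andP[s1 s2].
  exists (p, s, q) => //=; rewrite /V asboolT.
    by rewrite /B /=; split; rewrite ltr_norml; apply/andP; split; lra.
  move=> z [/= zp zs]; apply: eU; rewrite /ball /= -re norm_normc ltcR.
  apply: le_lt_trans (normc_le_ReIm _) _; rewrite !raddfB /=.
  move: zp zs; rewrite !ltr_norml => /andP[? ?] /andP[? ?].
  have : `|complex.Re (f x) - complex.Re z| < r / 2.
    by rewrite ltr_norml; apply/andP; split; lra.
  have : `|complex.Im (f x) - complex.Im z| < r / 2.
    by rewrite ltr_norml; apply/andP; split; lra.
  lra.
apply: countable_bigcupT_measurable; first exact: countableP.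
move=> q; rewrite /V; case: asboolP => _; last by rewrite preimage_set0.
have -> : f @^-1` B q =
  ([set: T] `&` (fun x => complex.Re (f x)) @^-1` ball (ratr q.1.1 : R) (ratr q.2)) `&`
  ([set: T] `&` (fun x => complex.Im (f x)) @^-1` ball (ratr q.1.2 : R) (ratr q.2)).
  rewrite !setTI; apply/seteqP; split => x /=; rewrite /ball /= !(distrC (ratr _)) //.
apply: measurableI; [apply: mre => //|apply: mim => //]; rewrite ball_itv; exact: measurable_itv.
Qed.

End complex_borel.

Record young_function (R : realType) := YoungFunction {
  young_fun :> R -> R;
  young_continuous : continuous young_fun;
  young_even : forall t, young_fun (- t) = young_fun t;
  (* [R^o] is [R] as a module over itself, where convex combinations live *)
  young_convex : convex_function [set: R^o] young_fun;
  young0 : young_fun 0 = 0;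
  young_gt0 : forall t, 0 < t -> 0 < young_fun t;
  young_cvgy : young_fun t @[t --> +oo%R] --> +oo%R
}.

Section young_theory.
Context {R : realType} (Phi : young_function R).
Implicit Types c s t x y : R.

Lemma young_conv c x y : 0 <= c -> c <= 1 ->
  Phi (c * x + (1 - c) * y) <= c * Phi x + (1 - c) * Phi y.
Proof.
move=> c0 c1.
exact: (@young_convex _ Phi (Itv01 c0 c1) x y (in_setT _) (in_setT _)).
Qed.

Lemma young_ge0 t : 0 <= Phi t.
Proof.
have [t0|t0|<-] := ltgtP 0 t; last by rewrite young0.
  exact/ltW/young_gt0.
by rewrite -young_even; apply/ltW/young_gt0; rewrite oppr_gt0.
Qed.

Lemma young_eq0 t : Phi t = 0 -> t = 0.
Proof.
have [t0|t0|//] := ltgtP t 0 => Pt.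
  by have := @young_gt0 _ Phi (- t); rewrite young_even Pt ltxx oppr_gt0 => /(_ t0).
by have := young_gt0 Phi t0; rewrite Pt ltxx.
Qed.

Lemma young_scale c t : 0 <= c -> c <= 1 -> Phi (c * t) <= c * Phi t.
Proof.
move=> c0 c1; have := young_conv t 0 c0 c1.
by rewrite young0 !mulr0 !addr0.
Qed.

Lemma young_le x y : 0 <= x -> x <= y -> Phi x <= Phi y.
Proof.
move=> x0 xy; have [y0|y0] := eqVneq y 0.
  by have -> : x = y by apply/le_anti; rewrite xy y0 x0.
have yp : 0 < y by rewrite lt_neqAle eq_sym y0 (le_trans x0).
have -> : x = (x / y) * y by rewrite mulfVK.
have c0 : 0 <= x / y by rewrite divr_ge0// ltW.
have c1 : x / y <= 1 by rewrite ler_pdivrMr// mul1r.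
by rewrite (le_trans (young_scale y c0 c1))// ler_piMl// young_ge0.
Qed.

Lemma measurable_young : measurable_fun [set: R] Phi.
Proof. by apply: continuous_measurable_fun; exact: young_continuous. Qed.

End young_theory.

Section orlicz_pred.
Context d (T : measurableType d) (R : realType).
Variables (mu : {measure set T -> \bar R}) (Phi : young_function R).
Local Notation C := (R[i]^o).
Implicit Types f g : T -> C.

Definition is_orlicz f :=
  measurable_fun [set: T] (f : T -> borel C) /\
  exists2 alpha : R, 0 < alpha &
    (\int[mu]_x (Phi (alpha * normc (f x)))%:E < +oo)%E.

(* The Luxemburg seminorm N_Phi on functions; [normc z : R] is the modulus of
   [z], whereas [`|z|] is the same number seen in [R[i]]. *)
Definition luxemburg f : R :=
  inf [set k | 0 < k /\ (\int[mu]_x (Phi (normc (f x) / k))%:E <= 1)%E].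

Lemma measurable_normc f : measurable_fun [set: T] (f : T -> borel C) ->
  measurable_fun [set: T] (fun x => normc (f x)).
Proof.
move=> mf; apply: (measurableT_comp _ mf); apply: borel_continuous_real.
exact: continuous_normc.
Qed.

Lemma measurable_young_normc f c : measurable_fun [set: T] (f : T -> borel C) ->
  measurable_fun [set: T] (fun x => (Phi (c * normc (f x)))%:E).
Proof.
move=> mf; apply/measurable_EFinP.
apply: (measurableT_comp (measurable_young Phi)).
by apply: measurable_funM => //; exact: measurable_normc.
Qed.

Lemma measurable_complexD f g : measurable_fun [set: T] (f : T -> borel C) ->
  measurable_fun [set: T] (g : T -> borel C) ->
  measurable_fun [set: T] ((f + g) : T -> borel C).
Proof.
move=> /measurable_complexP[f1 f2] /measurable_complexP[g1 g2].
apply/measurable_complexP; split.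
  by under eq_fun do rewrite raddfD; exact: measurable_funD.
by under eq_fun do rewrite raddfD; exact: measurable_funD.
Qed.

Lemma ReM (z w : R[i]) : complex.Re (z * w) =
  complex.Re z * complex.Re w - complex.Im z * complex.Im w.
Proof. by case: z w => [a b] [c e]. Qed.

Lemma ImM (z w : R[i]) : complex.Im (z * w) =
  complex.Re z * complex.Im w + complex.Im z * complex.Re w.
Proof. by case: z w => [a b] [c e]. Qed.

Lemma measurable_complexM f g : measurable_fun [set: T] (f : T -> borel C) ->
  measurable_fun [set: T] (g : T -> borel C) ->
  measurable_fun [set: T] ((fun x => f x * g x) : T -> borel C).
Proof.
move=> /measurable_complexP[f1 f2] /measurable_complexP[g1 g2].
apply/measurable_complexP; split.
  under eq_fun do rewrite ReM.
  by apply: measurable_funB; exact: measurable_funM.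
under eq_fun do rewrite ImM.
by apply: measurable_funD; exact: measurable_funM.
Qed.

Lemma measurable_complex_cst (c : C) :
  measurable_fun [set: T] ((fun=> c) : T -> borel C).
Proof. exact: measurable_cst. Qed.

Lemma le_int_young f g (a b : R) :
  measurable_fun [set: T] (f : T -> borel C) ->
  measurable_fun [set: T] (g : T -> borel C) ->
  0 <= a -> (forall x, a * normc (f x) <= b * normc (g x)) ->
  (\int[mu]_x (Phi (a * normc (f x)))%:E <=
   \int[mu]_x (Phi (b * normc (g x)))%:E)%E.
Proof.
move=> mf mg a0 fg; apply: ge0_le_integral => //.
- by move=> x _; rewrite lee_fin young_ge0.
- exact: measurable_young_normc.
- exact: measurable_young_normc.
- by move=> x _; rewrite lee_fin young_le// mulr_ge0// normc_ge0.
Qed.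

Lemma int_young_conv f g (a b c : R) :
  measurable_fun [set: T] (f : T -> borel C) ->
  measurable_fun [set: T] (g : T -> borel C) ->
  0 <= a -> 0 <= b -> 0 <= c -> c <= 1 ->
  forall k, 0 <= k -> k <= c * a -> k <= (1 - c) * b ->
  (\int[mu]_x (Phi (k * normc (f x + g x)))%:E <=
   c%:E * \int[mu]_x (Phi (a * normc (f x)))%:E +
   (1 - c)%:E * \int[mu]_x (Phi (b * normc (g x)))%:E)%E.
Proof.
move=> mf mg a0 b0 c0 c1 k k0 ka kb.
have d0 : 0 <= 1 - c by rewrite subr_ge0.
rewrite -!ge0_integralZl//; first last.
- by move=> x _; rewrite lee_fin young_ge0.
- exact: measurable_young_normc.
- by move=> x _; rewrite lee_fin young_ge0.
- exact: measurable_young_normc.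
rewrite -ge0_integralD//; first last.
- by apply: measurable_funeM; exact: measurable_young_normc.
- by move=> x _; rewrite mule_ge0// lee_fin young_ge0.
- by apply: measurable_funeM; exact: measurable_young_normc.
- by move=> x _; rewrite mule_ge0// lee_fin young_ge0.
apply: ge0_le_integral => //.
- by move=> x _; rewrite lee_fin young_ge0.
- by apply: (@measurable_young_normc (f + g)); exact: measurable_complexD.
- by apply: emeasurable_funD; apply: measurable_funeM; exact: measurable_young_normc.
move=> x _; rewrite -!EFinM -EFinD lee_fin.
apply: le_trans (young_conv Phi _ _ c0 c1).
apply: young_le; first by rewrite mulr_ge0// normc_ge0.
apply: (@le_trans _ _ (k * normc (f x) + k * normc (g x))).
  by rewrite -mulrDr ler_wpM2l// le_normcD.
by rewrite !mulrA lerD// ler_wpM2r// normc_ge0.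
Qed.

Lemma is_orlicz0 : is_orlicz 0.
Proof.
split; first exact: measurable_complex_cst.
exists 1 => //; rewrite integral0_eq// => x _.
by rewrite [normc _]normc0 mulr0 young0.
Qed.

Lemma is_orliczD f g : is_orlicz f -> is_orlicz g -> is_orlicz (f + g).
Proof.
move=> [mf [a a0 fa]] [mg [b b0 gb]]; split; first exact: measurable_complexD.
exists (Num.min a b / 2); first by rewrite divr_gt0// lt_min a0 b0.
have h0 : 0 <= 1 / 2 :> R by rewrite divr_ge0.
have h1 : 1 / 2 <= 1 :> R by lra.
have m0 : 0 <= Num.min a b / 2 by rewrite divr_ge0// le_min !ltW.
have ma : Num.min a b / 2 <= 1 / 2 * a.
  by have : Num.min a b <= a; [rewrite ge_min lexx|lra].
have mb : Num.min a b / 2 <= (1 - 1 / 2) * b.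
  by have : Num.min a b <= b; [rewrite ge_min lexx orbT|lra].
apply: (le_lt_trans (int_young_conv mf mg (ltW a0) (ltW b0) h0 h1 m0 ma mb)).
by apply: lte_add_pinfty; apply: lte_mul_pinfty => //; rewrite lee_fin; lra.
Qed.

Lemma is_orliczM (h : T -> C) f (B : R) :
  measurable_fun [set: T] (h : T -> borel C) -> (forall x, normc (h x) <= B) ->
  is_orlicz f -> is_orlicz (fun x => h x * f x).
Proof.
move=> mh hB [mf [a a0 fa]]; split; first exact: measurable_complexM.
have B1 : 0 < `|B| + 1 by rewrite ltr_wpDl.
exists (a / (`|B| + 1)); first by rewrite divr_gt0.
apply: le_lt_trans fa; apply: le_int_young => //.
- exact: measurable_complexM.
- by rewrite divr_ge0// ltW.
move=> x; rewrite normcM mulrA ler_wpM2r ?normc_ge0//.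
rewrite mulrAC ler_pdivrMr// ler_wpM2l ?(ltW a0)//.
by rewrite (le_trans (hB x))// (le_trans (ler_norm _))// ltW// ltrDl.
Qed.

Lemma is_orliczZ (c : R[i]) f : is_orlicz f -> is_orlicz (c *: f).
Proof.
by move=> fL; apply: (@is_orliczM (fun=> c) f (normc c)) => //; exact: measurable_complex_cst.
Qed.

Lemma luxemburg_has_lbound f :
  has_lbound [set k | 0 < k /\ (\int[mu]_x (Phi (normc (f x) / k))%:E <= 1)%E].
Proof. by exists 0 => k [/ltW]. Qed.

Lemma luxemburg_nonempty f : is_orlicz f ->
  [set k | 0 < k /\ (\int[mu]_x (Phi (normc (f x) / k))%:E <= 1)%E] !=set0.
Proof.
move=> [mf [a a0]]; set I := (\int[mu]_x _)%E => Ioo.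
have I0 : (0 <= I)%E by apply: integral_ge0 => x _; rewrite lee_fin young_ge0.
have If : I \is a fin_num by rewrite ge0_fin_numE.
pose J := fine I + 1.
have J1 : 1 <= J by rewrite lerDr fine_ge0.
have J0 : 0 < J by rewrite (lt_le_trans _ J1).
exists (J / a); split; first by rewrite divr_gt0.
apply: (@le_trans _ _ ((J^-1)%:E * I)%E); last first.
  rewrite -(fineK If) -EFinM lee_fin mulrC ler_pdivrMr// mul1r /J lerDl//.
rewrite /I -ge0_integralZl//; first last.
- by rewrite lee_fin invr_ge0 ltW.
- by move=> x _; rewrite lee_fin young_ge0.
- exact: measurable_young_normc.
apply: ge0_le_integral => //.
- by move=> x _; rewrite lee_fin young_ge0.
- by under eq_fun do rewrite mulrC; exact: measurable_young_normc.
- by apply: measurable_funeM; exact: measurable_young_normc.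
move=> x _; rewrite -EFinM lee_fin invf_div.
have -> : normc (f x) * (a / J) = J^-1 * (a * normc (f x)) by ring.
by apply: young_scale; [rewrite invr_ge0 ltW|rewrite invf_le1].
Qed.

Lemma luxemburg_ge0 f : 0 <= luxemburg f.
Proof.
have [[x Sx]|] := pselect ([set k | 0 < k /\
    (\int[mu]_x (Phi (normc (f x) / k))%:E <= 1)%E] !=set0).
  by apply: lb_le_inf; [exists x|move=> k [/ltW]].
by move=> /set0P/negP/negbNE/eqP S0; rewrite /luxemburg S0 inf0.
Qed.

Lemma luxemburgD f g : is_orlicz f -> is_orlicz g ->
  luxemburg (f + g) <= luxemburg f + luxemburg g.
Proof.
move=> Lf Lg; apply/ler_addgt0Pr => e e0.
have e2 : 0 < e / 2 by rewrite divr_gt0.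
have [s [s0 fs] sf] := inf_adherent e2 (conj (luxemburg_nonempty Lf) (luxemburg_has_lbound f)).
have [t [t0 gt] tg] := inf_adherent e2 (conj (luxemburg_nonempty Lg) (luxemburg_has_lbound g)).
apply: (@le_trans _ _ (s + t)); last first.
  by rewrite /luxemburg; move: sf tg; lra.
apply: ge_inf; first exact: luxemburg_has_lbound.
have st : 0 < s + t by rewrite addr_gt0.
split=> //; under eq_integral do rewrite mulrC.
have s1 : 0 <= s^-1 by rewrite invr_ge0 ltW.
have t1 : 0 <= t^-1 by rewrite invr_ge0 ltW.
have c0 : 0 <= s / (s + t) by rewrite divr_ge0// ltW.
have c1 : s / (s + t) <= 1 by rewrite ler_pdivrMr// mul1r lerDl ltW.
have k0 : 0 <= (s + t)^-1 by rewrite invr_ge0 ltW.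
have ks : (s + t)^-1 <= s / (s + t) * s^-1.
  by rewrite mulrAC divff ?mul1r// gt_eqF.
have kt : (s + t)^-1 <= (1 - s / (s + t)) * t^-1.
  have -> : 1 - s / (s + t) = t / (s + t) by field; rewrite gt_eqF.
  by rewrite mulrAC divff ?mul1r// gt_eqF.
apply: (le_trans (int_young_conv Lf.1 Lg.1 s1 t1 c0 c1 k0 ks kt)).
have -> : (1 = (s / (s + t))%:E * 1 + (1 - s / (s + t))%:E * 1 :> \bar R)%E.
  by rewrite !mule1 -EFinD addrC subrK.
apply: leeD; apply: lee_wpmul2l; rewrite ?lee_fin ?subr_ge0//.
  by under eq_integral do rewrite mulrC.
by under eq_integral do rewrite mulrC.
Qed.

Lemma luxemburg0 : luxemburg 0 = 0.
Proof.
apply/le_anti; rewrite luxemburg_ge0 andbT; apply/ler_addgt0Pr => e e0.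
rewrite add0r; apply: ge_inf; first exact: luxemburg_has_lbound.
split=> //; rewrite integral0_eq// => x _.
by rewrite [normc _]normc0 mul0r young0.
Qed.

Let luxemburgZ_le (c : R[i]) f : c != 0 -> is_orlicz f ->
  luxemburg (c *: f) <= normc c * luxemburg f.
Proof.
move=> c0 Lf; have nc : 0 < normc c.
  by rewrite lt_neqAle normc_ge0 andbT eq_sym; apply: contra c0 => /eqP/eq0_normc/eqP.
rewrite -ler_pdivrMl//; apply: lb_le_inf; first exact: luxemburg_nonempty.
move=> k [k0 fk]; rewrite ler_pdivrMl//.
apply: ge_inf; first exact: luxemburg_has_lbound.
split; first by rewrite mulr_gt0.
under eq_integral => x _.
  rewrite [normc _](_ : _ = normc c * normc (f x)); last exact: normcM.
  rewrite -mulf_div divff ?gt_eqF// mul1r; over.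
by [].
Qed.

Lemma luxemburgZ (c : R[i]) f : is_orlicz f ->
  luxemburg (c *: f) = normc c * luxemburg f.
Proof.
move=> Lf; have [->|c0] := eqVneq c 0.
  by rewrite scale0r luxemburg0 normc0 mul0r.
have nc : 0 < normc c.
  by rewrite lt_neqAle normc_ge0 andbT eq_sym; apply: contra c0 => /eqP/eq0_normc/eqP.
apply/le_anti; rewrite luxemburgZ_le//= -ler_pdivlMl// -normcV.
apply: le_trans (luxemburgZ_le _ (is_orliczZ c Lf)); last by rewrite invr_eq0.
by rewrite scalerA mulVf// scale1r.
Qed.

Lemma luxemburg_eq0 f : is_orlicz f -> luxemburg f = 0 -> f = 0 %[ae mu].
Proof.
move=> Lf f0.
have mP : measurable_fun [set: T] (fun x => (Phi (normc (f x)))%:E).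
  by under eq_fun do rewrite -[normc _]mul1r; exact: measurable_young_normc Lf.1.
have : (\int[mu]_x `|(Phi (normc (f x)))%:E| = 0)%E.
  under eq_integral do rewrite gee0_abs ?lee_fin ?young_ge0//.
  apply/le_anti/andP; split; last first.
    by apply: integral_ge0 => x _; rewrite lee_fin young_ge0.
  apply/lee_addgt0Pr => e e0; rewrite add0e.
  have me : 0 < Num.min e 1 by rewrite lt_min e0 ltr01.
  have [k [k0 fk]] := inf_adherent me (conj (luxemburg_nonempty Lf) (luxemburg_has_lbound f)).
  rewrite -/(luxemburg f) f0 add0r lt_min => /andP[ke k1].
  apply: (@le_trans _ _ k%:E); last by rewrite lee_fin ltW.
  apply: (@le_trans _ _ (k%:E * \int[mu]_x (Phi (normc (f x) / k))%:E)%E); last first.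
    by rewrite -[leRHS]mule1 lee_wpmul2l// lee_fin ltW.
  have mk : measurable_fun [set: T] (fun x => (Phi (normc (f x) / k))%:E).
    by under eq_fun do rewrite mulrC; exact: measurable_young_normc Lf.1.
  rewrite -ge0_integralZl//; first last.
  - by rewrite lee_fin ltW.
  - by move=> x _; rewrite lee_fin young_ge0.
  apply: ge0_le_integral => //.
  - by move=> x _; rewrite lee_fin young_ge0.
  - by apply: measurable_funeM.
  move=> x _; rewrite -EFinM lee_fin.
  rewrite [X in Phi X <= _](_ : _ = k * (normc (f x) / k)).
    by apply: young_scale; exact: ltW.
  by rewrite mulrC mulfVK// gt_eqF.
move=> /(ae_eq_integral_abs mu measurableT mP).
apply: filterS => x /= /(_ I) [] /young_eq0 /eq0_normc fx0 _; exact: fx0.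
Qed.

Lemma luxemburg_ae f g : is_orlicz f -> is_orlicz g ->
  f = g %[ae mu] -> luxemburg f = luxemburg g.
Proof.
move=> Lf Lg fg; rewrite /luxemburg; congr inf; apply/seteqP; split => k [k0];
  move=> H; split=> //; apply: le_trans H; rewrite le_eqVlt; apply/orP; left; apply/eqP.
- apply: ae_eq_integral => //.
  + by under eq_fun do rewrite mulrC; exact: measurable_young_normc Lg.1.
  + by under eq_fun do rewrite mulrC; exact: measurable_young_normc Lf.1.
  + by apply: filterS fg => x /= /[apply] ->.
- apply: ae_eq_integral => //.
  + by under eq_fun do rewrite mulrC; exact: measurable_young_normc Lf.1.
  + by under eq_fun do rewrite mulrC; exact: measurable_young_normc Lg.1.
  + by apply: filterS fg => x /= /[apply] ->.
Qed.

End orlicz_pred.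

Section orlicz_fun.
Context d (T : measurableType d) (R : realType).
Variables (mu : {measure set T -> \bar R}) (Phi : young_function R).
Local Notation C := (R[i]^o).

Definition orlicz_pred : {pred T -> C} := [pred f | `[< is_orlicz mu Phi f >]].

Lemma orlicz_predP (f : T -> C) : reflect (is_orlicz mu Phi f) (f \in orlicz_pred).
Proof. exact: asboolP. Qed.

Lemma orlicz_submod_closed : submod_closed orlicz_pred.
Proof.
split; first exact/orlicz_predP/is_orlicz0.
move=> a f g /orlicz_predP Lf /orlicz_predP Lg; apply/orlicz_predP.
by apply: is_orliczD => //; exact: is_orliczZ.
Qed.

HB.instance Definition _ :=
  GRing.isSubmodClosed.Build R[i] (T -> C) orlicz_pred orlicz_submod_closed.

Record orlicz_fun := OrliczFun {
  orlicz_val :> T -> C;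
  orlicz_valP : orlicz_val \in orlicz_pred
}.

HB.instance Definition _ := [isSub for orlicz_val].
HB.instance Definition _ := [Choice of orlicz_fun by <:].
HB.instance Definition _ := [SubChoice_isSubLmodule of orlicz_fun by <:].

Lemma orlicz_funP (f : orlicz_fun) : is_orlicz mu Phi f.
Proof. exact/orlicz_predP/orlicz_valP. Qed.

Definition orlicz_null : {pred orlicz_fun} :=
  [pred f : orlicz_fun | `[< (f : T -> C) = 0 %[ae mu] >]].

Lemma orlicz_nullP (f : orlicz_fun) :
  reflect ((f : T -> C) = 0 %[ae mu]) (f \in orlicz_null).
Proof. exact: asboolP. Qed.

Lemma orlicz_null_submod_closed : submod_closed orlicz_null.
Proof.
split; first by apply/orlicz_nullP; exact: aeW.
move=> a f g /orlicz_nullP f0 /orlicz_nullP g0; apply/orlicz_nullP.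
near=> x => _; rewrite /= [LHS](_ : _ = a * f x + g x) //.
have -> : f x = 0 by near: x; apply: filterS f0 => x; exact.
have -> : g x = 0 by near: x; apply: filterS g0 => x; exact.
by rewrite mulr0 addr0.
Unshelve. all: by end_near. Qed.

HB.instance Definition _ :=
  GRing.isSubmodClosed.Build R[i] orlicz_fun orlicz_null orlicz_null_submod_closed.

(* L^Phi(mu): Orlicz functions modulo equality mu-a.e.  The instances below make
   it a [normedModType R[i]], whose topology is that of the Luxemburg norm;
   norms over [R[i]] take their values in [R[i]], cf. [orlicz_normE]. *)
Definition orlicz_space : Type := {ideal_quot orlicz_null}.
HB.instance Definition _ := GRing.Zmodule.on orlicz_space.
HB.instance Definition _ := EqQuotient.on orlicz_space.

Definition orlicz_class (f : orlicz_fun) : orlicz_space := \pi_orlicz_space f.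

Lemma orlicz_classP (f g : orlicz_fun) :
  orlicz_class f = orlicz_class g <-> (f : T -> C) = g %[ae mu].
Proof.
have E : (orlicz_class f == orlicz_class g) = (f - g \in orlicz_null).
  by rewrite -Quotient.idealrBE.
split=> [/eqP|fg].
  rewrite E => /orlicz_nullP; apply: filterS => x /(_ I) fg _.
  by apply/eqP; rewrite -subr_eq0; apply/eqP.
apply/eqP; rewrite E; apply/orlicz_nullP.
by apply: filterS fg => x /(_ I) fgx _; rewrite -[LHS]/(f x - g x) fgx subrr.
Qed.

Definition orlicz_repr (u : orlicz_space) : orlicz_fun := repr u.

Lemma orlicz_reprK u : orlicz_class (orlicz_repr u) = u.
Proof. exact: reprK. Qed.

Lemma orlicz_class_repr f : (orlicz_repr (orlicz_class f) : T -> C) = f %[ae mu].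
Proof. by apply/orlicz_classP; rewrite orlicz_reprK. Qed.

Lemma orlicz_classD : {morph orlicz_class : f g / f + g}.
Proof. by move=> f g; rewrite /orlicz_class piE. Qed.

Lemma orlicz_class0 : orlicz_class 0 = 0.
Proof. by rewrite /orlicz_class piE. Qed.

Definition orlicz_scale (c : R[i]) (u : orlicz_space) : orlicz_space :=
  orlicz_class (c *: orlicz_repr u).

Lemma orlicz_scale_class c f : orlicz_scale c (orlicz_class f) = orlicz_class (c *: f).
Proof.
apply/orlicz_classP; have := orlicz_class_repr f.
by apply: filterS => x /(_ I) fx _; rewrite -[RHS]/(c *: f x) -fx.
Qed.

Let orlicz_scalerA a b u : orlicz_scale a (orlicz_scale b u) = orlicz_scale (a * b) u.
Proof. by rewrite -(orlicz_reprK u) !orlicz_scale_class scalerA. Qed.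

Let orlicz_scale1r : left_id 1 orlicz_scale.
Proof. by move=> u; rewrite -(orlicz_reprK u) !orlicz_scale_class scale1r. Qed.

Let orlicz_scalerDr : right_distributive orlicz_scale +%R.
Proof.
move=> a u v; rewrite -(orlicz_reprK u) -(orlicz_reprK v).
by rewrite -orlicz_classD !orlicz_scale_class scalerDr orlicz_classD.
Qed.

Let orlicz_scalerDl u : {morph orlicz_scale^~ u : a b / a + b}.
Proof.
move=> a b; rewrite -(orlicz_reprK u).
by rewrite !orlicz_scale_class scalerDl orlicz_classD.
Qed.

HB.instance Definition _ := GRing.Zmodule_isLmodule.Build R[i] orlicz_space
  orlicz_scalerA orlicz_scale1r orlicz_scalerDr orlicz_scalerDl.

Definition orlicz_norm (u : orlicz_space) : R := luxemburg mu Phi (orlicz_repr u).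

Lemma orlicz_norm_class f : orlicz_norm (orlicz_class f) = luxemburg mu Phi f.
Proof. by apply: luxemburg_ae; [exact: orlicz_funP..|exact: orlicz_class_repr]. Qed.

Let orlicz_ler_normD u v :
  (orlicz_norm (u + v))%:C <= (orlicz_norm u)%:C + (orlicz_norm v)%:C.
Proof.
rewrite -(orlicz_reprK u) -(orlicz_reprK v) -orlicz_classD !orlicz_norm_class.
by rewrite -rmorphD lecR; apply: luxemburgD; exact: orlicz_funP.
Qed.

Let orlicz_normrZ c u : (orlicz_norm (c *: u))%:C = `|c| * (orlicz_norm u)%:C.
Proof.
rewrite -(orlicz_reprK u) [c *: _]orlicz_scale_class !orlicz_norm_class.
by rewrite norm_normc -rmorphM luxemburgZ//; exact: orlicz_funP.
Qed.

Let orlicz_normr0_eq0 u : (orlicz_norm u)%:C = 0 -> u = 0.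
Proof.
rewrite -(orlicz_reprK u) -orlicz_class0 orlicz_norm_class => -[f0].
by apply/orlicz_classP; apply: luxemburg_eq0 f0; exact: orlicz_funP.
Qed.

HB.instance Definition _ := Lmodule_isNormed.Build R[i] orlicz_space
  orlicz_ler_normD orlicz_normrZ orlicz_normr0_eq0.

Lemma orlicz_normE (u : orlicz_space) : `|u| = (orlicz_norm u)%:C.
Proof. by []. Qed.

End orlicz_fun.

(* The distinguished point is unconstrained: it is there only because
   [g_sigma_algebraType] builds a measurable type from a pointed type. *)
HB.mixin Record isTopologicalGroup G & PointedTopological G & Group G := {
  mulg_continuous : continuous (fun xy : G * G => (xy.1 * xy.2)%g);
  invg_continuous : continuous (fun x : G => (x^-1)%g)
}.

#[short(type="topologicalGroupType")]
HB.structure Definition TopologicalGroup :=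
  {G of isTopologicalGroup G & PointedTopological G & Group G}.

Definition closed_subgroup (G : topologicalGroupType) (H : set G) :=
  group_closed (mem H) /\ closed H.

(* [smallest _ [set a]] is the closed subgroup generated by [a]. *)
Definition aperiodic (G : topologicalGroupType) (a : G) :=
  ~ compact (smallest (@closed_subgroup G) [set a]).

(* A right Haar measure: a nonzero right-invariant Radon measure. *)
Definition is_right_haar (G : topologicalGroupType) (R : realType)
    (mu : {measure set (borel G) -> \bar R}) :=
  [/\ mu [set: borel G] != 0%E,
      forall K : set G, compact K -> (mu K < +oo)%E,
      forall A : set (borel G), measurable A ->
        mu A = ereal_inf [set mu U | U in [set U : set G | open U /\ A `<=` U]],
      forall U : set G, open U ->
        mu U = ereal_sup [set mu K | K in [set K : set G | compact K /\ K `<=` U]] &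
      forall (A : set (borel G)) (a : G), measurable A ->
        mu [set (x * a)%g | x in A] = mu A].

Record right_haar_measure (G : topologicalGroupType) (R : realType) :=
  RightHaarMeasure {
    haar_measure :> {measure set (borel G) -> \bar R};
    haar_measureP : is_right_haar haar_measure
  }.

Record weight (G : topologicalGroupType) (R : realType) := Weight {
  weight_fun :> G -> R;
  weight_continuous : continuous weight_fun;
  weight_gt0 : forall x, 0 < weight_fun x;
  weight_bounded : exists B : R, forall x, weight_fun x <= B
}.

Definition delta2_regular (G : topologicalGroupType) (R : realType)
    (Phi : young_function R) :=
  exists M t0 : R, [/\ 0 < M, 0 < t0,
    compact [set: G] -> forall t, t0 <= t -> Phi (2 * t) <= M * Phi t &
    ~ compact [set: G] -> forall t, 0 < t -> Phi (2 * t) <= M * Phi t].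

Section weighted_translation.
Context (G : topologicalGroupType) (R : realType).
Variables (lambda : right_haar_measure G R) (Phi : young_function R).
Local Notation C := (R[i]^o).
Implicit Types (a : G) (w : weight G R).

Lemma rtranslation_continuous a : continuous (fun x : G => (x * a)%g).
Proof.
move=> x; apply: (@cvg_comp _ _ _ (fun x => (x, a)) (fun xy => (xy.1 * xy.2)%g) _ (nbhs (x, a))).
  by apply: cvg_pair => /=; [exact: cvg_id|exact: cvg_cst].
exact: (@mulg_continuous G (x, a)).
Qed.

Lemma measurable_rtranslation a :
  measurable_fun [set: borel G] ((fun x : G => (x * a)%g) : borel G -> borel G).
Proof. by apply: borel_continuous; exact: rtranslation_continuous. Qed.

Lemma haar_rtranslation a (A : set (borel G)) : measurable A ->
  lambda ((fun x : G => (x * a)%g) @^-1` A) = lambda A.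
Proof.
move=> mA; have [_ _ _ _ inv] := haar_measureP lambda.
rewrite -[RHS](inv A (a^-1)%g mA); congr (lambda _).
apply/seteqP; split => [x /= Ax|_ /= [x Ax <-]].
  by exists (x * a)%g => //; rewrite mulgK.
by rewrite mulgVK.
Qed.

Lemma haar_integral_rtranslation a (f : borel G -> \bar R) :
  measurable_fun [set: borel G] f -> (forall x, (0 <= f x)%E) ->
  (\int[lambda]_x f (x * a)%g = \int[lambda]_x f x)%E.
Proof.
move=> mf f0.
have := @ge0_integral_pushforward _ _ _ _ R _ (measurable_rtranslation a) lambda setT f
  measurableT mf (fun y _ => f0 y).
rewrite preimage_setT => <-.
apply: eq_measure_integral; first exact: measurable_rtranslation.
by move=> ma A mA _; exact: haar_rtranslation.
Qed.

Lemma haar_ae_rtranslation a (P : G -> Prop) :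
  {ae lambda, forall x, P x} -> {ae lambda, forall x, P (x * a)%g}.
Proof.
move=> [N [mN N0 PN]]; exists ((fun x : G => (x * a)%g) @^-1` N); split.
- by rewrite -[X in measurable X]setTI; exact: measurable_rtranslation.
- by rewrite haar_rtranslation.
- by move=> x /= /PN.
Qed.

Definition weighted_translation_fun a (w : G -> R) (f : G -> C) : G -> C :=
  fun x => (w x)%:C * f (x * a^-1)%g.

Lemma is_orlicz_weighted_translation a w (f : G -> C) :
  is_orlicz lambda Phi f ->
  is_orlicz lambda Phi (weighted_translation_fun a w f).
Proof.
move=> [mf [c c0 fc]]; have [B wB] := weight_bounded w.
apply: (@is_orliczM _ _ _ lambda Phi (fun x : borel G => (w x)%:C) _ B).
- apply/measurable_complexP; split => /=.
    exact: (borel_continuous_real (@weight_continuous _ _ w)).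
  exact: measurable_cst.
- by move=> x; rewrite normc_real gtr0_norm// weight_gt0.
split; first exact: (measurableT_comp mf (measurable_rtranslation _)).
exists c => //.
rewrite (haar_integral_rtranslation _ (measurable_young_normc Phi c mf))//.
by move=> x; rewrite lee_fin young_ge0.
Qed.

Definition weighted_translation_orlicz a w (f : orlicz_fun lambda Phi) :
    orlicz_fun lambda Phi :=
  OrliczFun (introT (orlicz_predP _ _ _)
    (is_orlicz_weighted_translation a w (orlicz_funP f))).

(* Independent of the chosen representative: see [weighted_translation_class]. *)
Definition weighted_translation a w (u : orlicz_space lambda Phi) :
    orlicz_space lambda Phi :=
  orlicz_class (weighted_translation_orlicz a w (orlicz_repr u)).

Lemma weighted_translation_class a w (f : orlicz_fun lambda Phi) :
  weighted_translation a w (orlicz_class f) =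
  orlicz_class (weighted_translation_orlicz a w f).
Proof.
apply/orlicz_classP.
have /(haar_ae_rtranslation (a^-1)%g) := orlicz_class_repr f.
by apply: (@filterS _ _ (ae_filter_ringOfSetsType lambda)) => x /(_ I) fx _; rewrite /= /weighted_translation_fun fx.
Qed.

End weighted_translation.
Arguments weighted_translation {G R} lambda Phi a w u.

Definition disjoint_topologically_transitive (X : topologicalType) (L : nat)
    (A : 'I_L -> X -> X) :=
  forall (U : set X) (V : 'I_L -> set X),
    open U -> U !=set0 ->
    (forall l, open (V l)) -> (forall l, V l !=set0) ->
    exists2 n : nat, (1 <= n)%N &
      U `&` \bigcap_(l in [set: 'I_L]) (iter n (A l) @^-1` V l) !=set0.

Definition varphi (G : topologicalGroupType) (R : realType) (a : G) (w : G -> R)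
    (n : nat) (x : G) : R :=
  \prod_(1 <= j < n.+1) w (x * a ^+ j)%g.

Definition varphit (G : topologicalGroupType) (R : realType) (a : G) (w : G -> R)
    (n : nat) (x : G) : R :=
  (\prod_(0 <= j < n) w (x * a ^- j)%g)^-1.

(* The essential supremum norm of [f|_E]; [f \_ E] extends [f|_E] by [0]. *)
Definition ess_norm_on (G : topologicalGroupType) (R : realType)
    (mu : {measure set (borel G) -> \bar R}) (E : set G) (f : G -> R) : \bar R :=
  'N[mu]_+oo[EFin \o (f \_ E)]%E.

(* Main.v *)
Require Import Defs.
From HB Require Import structures.
From mathcomp Require Import all_boot all_order all_algebra.
From mathcomp Require Import all_classical all_reals all_analysis.
From mathcomp Require Import measurable_realfun ess_sup_inf complex.
From mathcomp Require Import lra zify.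
Import Order.TTheory GRing.Theory Num.Theory Normc.
Import numFieldNormedType.Exports.

Set Implicit Arguments.
Unset Strict Implicit.
Unset Printing Implicit Defensive.

Local Open Scope classical_set_scope.
Local Open Scope ring_scope.

(* Add to the operators [T_l^(r_l)] the identity as an operator of index [None]:
   disjoint transitivity then says that any targets [f_i] are simultaneously
   approximated by [A_i^n v] for one [v] and one [n], where [A_i^n] is
   multiplication by a cocycle after translation by [a^(-rho_i n)], and the
   products of condition (ii) are exactly the multipliers of [A_i^n A_j^-n],
   [i != j].
   If these multipliers are small on most of a compact set carrying bounded
   approximations [h_i] of the [f_i], take [v = sum_j A_j^-n (1_E h_j)]: in
   [A_i^n v] only the term [j = i] is not small.
   Conversely, approximate [f_i = c_i 1_K] with [c_i >= 1] by [A_i^n v], with [n]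
   so large that [K] and [K a^m] are disjoint for [m >= n]; this uses Weil's
   lemma that a monothetic group is compact as soon as it is recurrent.  With
   [z = y a^((rho_i - rho_j) n)], the multiplier at [y] is the ratio of
   [|A_i^n v z|], small since [z] is off [K], to [|A_j^n v y|], close to
   [c_j >= 1]. *)

(** * Recurrence in locally compact groups *)

Section monothetic.
Context (G : topologicalGroupType).
Implicit Types (a x y : G) (V W K : set G).
Local Open Scope group_scope.

Lemma mulg_cvg2 x y V : nbhs (x * y) V ->
  exists W1 W2, [/\ nbhs x W1, nbhs y W2 & forall s t, W1 s -> W2 t -> V (s * t)].
Proof.
move=> /(@mulg_continuous G (x, y))[[W1 W2] /= [W1x W2y] WV].
by exists W1, W2; split=> // s t W1s W2t; exact: (WV (s, t)).
Qed.

Lemma ltranslation_continuous x : continuous (fun y : G => x * y).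
Proof.
move=> y; apply: (@cvg_comp _ _ _ (fun y => (x, y)) (fun xy => xy.1 * xy.2) _ (nbhs (x, y))).
  by apply: cvg_pair => /=; [exact: cvg_cst|exact: cvg_id].
exact: (@mulg_continuous G (x, y)).
Qed.

Lemma nbhs_ltranslation x y V : nbhs (x * y) V -> nbhs y [set z | V (x * z)].
Proof. exact: ltranslation_continuous. Qed.

Lemma nbhs1_inv V : nbhs 1 V -> nbhs 1 [set x : G | V x^-1].
Proof. by move=> V1; apply: (@invg_continuous G 1); rewrite invg1. Qed.

(** This is the integer power [a^(q - p)], kept as a pair of natural exponents; by [divpow_eq] only
    the difference of the two matters. *)
Definition divpow a p q : G := a ^- p * a ^+ q.

Lemma expg_comm a p q : a ^- p * a ^+ q = a ^+ q * a ^- p.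
Proof.
apply: (mulgI (a ^+ p)); rewrite mulgA mulgV mul1g mulgA -expgnDr addnC expgnDr.
by rewrite -mulgA mulgV mulg1.
Qed.

Lemma expgVD a p q : a ^- (p + q) = a ^- p * a ^- q :> G.
Proof. by rewrite addnC expgnDr invgM. Qed.

Lemma divpowM a p q p' q' : divpow a p q * divpow a p' q' = divpow a (p + p') (q + q').
Proof.
rewrite /divpow expgVD expgnDr !mulgA; congr (_ * _).
by rewrite -!mulgA; congr (_ * _); rewrite expg_comm.
Qed.

Lemma divpowV a p q : (divpow a p q)^-1 = divpow a q p.
Proof. by rewrite /divpow invgM invgK. Qed.

Lemma divpow0 a n : divpow a 0 n = a ^+ n.
Proof. by rewrite /divpow expg0 invg1 mul1g. Qed.

Lemma divpow_eq a p q p' q' : (p + q')%N = (p' + q)%N -> divpow a p q = divpow a p' q'.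
Proof.
move=> e; rewrite /divpow; apply: (mulgI (a ^+ (p + p'))).
rewrite !mulgA {1}addnC !expgnDr.
rewrite -[a ^+ p' * _ * _]mulgA mulgV mulg1 -[a ^+ p * _ * _]mulgA mulgV mulg1.
by rewrite -!expgnDr e.
Qed.

(** The powers of [a] lying in [K] cluster at some [c]; two of them near [c] have a quotient near 1,
    and their exponents can be taken as far apart as desired. *)
Lemma exp_recurrent a K : compact K ->
  (forall N, exists2 n, (N <= n)%N & K (a ^+ n)) ->
  forall V, nbhs 1 V -> forall N, exists2 n, (N <= n)%N & V (a ^+ n).
Proof.
move=> cK rK V V1 N.
have [u uP] : {u : nat -> nat & forall k, (k <= u k)%N /\ K (a ^+ u k)}.
  by apply: (@choice _ _ (fun k n => (k <= n)%N /\ K (a ^+ n))) => k; have [n] := rK k; exists n.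
have uK : ((fun k => a ^+ u k) @ \oo) K by exists 0%N => // k _; exact: (uP k).2.
have [c [Kc clc]] := cK _ _ uK.
have [|W1 [W2 [n1 n2 W12]]] := @mulg_cvg2 1 1 V; first by rewrite mulg1.
(* For [g] and [h] in [U], the product [g^-1 h = (c^-1 g)^-1 (c^-1 h)] lies in [W1 W2], hence in
   [V]. *)
pose U : set G := [set h | W1 (c^-1 * h)^-1 /\ W2 (c^-1 * h)].
have nU : nbhs c U.
  have e : nbhs (c^-1 * c) = nbhs 1 by rewrite mulVg.
  apply: (@filterI _ _ _ [set h | W1 (c^-1 * h)^-1] [set h | W2 (c^-1 * h)]).
    by apply: (@nbhs_ltranslation _ _ [set x | W1 x^-1]); rewrite e; exact: nbhs1_inv.
  by apply: nbhs_ltranslation; rewrite e.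
have rU M : exists2 n, (M <= n)%N & U (a ^+ n).
  have [|_ [[k /= Mk <-] Uk]] := clc [set a ^+ u k | k in [set k | (M <= k)%N]] U _ nU.
    by exists M => // k /= Mk; exists k.
  by exists (u k) => //; exact: leq_trans Mk (uP k).1.
have [n _ [Un _]] := rU 0%N; have [m nm [_ Um]] := rU (N + n)%N.
exists (m - n)%N; first by rewrite leq_subRL ?(leq_trans _ nm) ?leq_addl// addnC.
suff -> : a ^+ (m - n) = (c^-1 * a ^+ n)^-1 * (c^-1 * a ^+ m) by exact: W12.
rewrite invgM invgK -mulgA mulVKg.
rewrite -divpow0 -/(divpow a n m); apply: divpow_eq.
by rewrite add0n subnKC// (leq_trans _ nm)// leq_addl.
Qed.

(** Continuity of the operations carries the group laws from the integer powers of [a] to their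
    limits. This closure therefore contains the closed subgroup generated by [a]. *)
Lemma closure_monothetic_subgroup a :
  closed_subgroup (closure [set divpow a pq.1 pq.2 | pq in [set: nat * nat]]).
Proof.
set S := [set _ | _ in _]; split; last exact: closed_closure.
split; first by rewrite inE; apply: subset_closure; exists (0, 0)%N => //=; rewrite divpow0.
move=> x y; rewrite !inE => cx cy V /=.
move=> /mulg_cvg2[W1 [W2 [n1 n2 W12]]].
have [_ [[[p q] _ <-] Ws]] := cx _ n1.
have nV : nbhs y [set z | W2 z^-1] by apply: (@invg_continuous G y).
have [_ [[[p' q'] _ <-] Wt]] := cy _ nV.
exists (divpow a (p + q') (q + p')); split; first by exists (p + q', q + p')%N.
by rewrite -divpowM -(@divpowV _ p' q'); exact: W12.
Qed.

(* Weil's lemma: a recurrent monothetic group is compact.  If [V] is a symmetric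
   relatively compact neighborhood of [1], finitely many [a^j V] with [j >= 1]
   cover [closure V]; hence the least [m >= 1] with [a^m \in x V] is bounded
   independently of [x]. *)
Lemma recurrent_compact a : hausdorff_space G -> locally_compact [set: G] ->
  (forall V, nbhs 1 V -> forall N, exists2 n, (N <= n)%N & V (a ^+ n)) ->
  compact (smallest (@closed_subgroup G) [set a]).
Proof.
move=> hG lG ra.
have [V0 + [cV0 _]] := lG 1 I; rewrite withinET => V01.
have [V [oV V1 VV0 VV]] : exists V : set G, [/\ open V, V 1, V `<=` V0 & forall x, V x -> V x^-1].
  move: V01; rewrite nbhsE => -[V [oV V1] VV0]; exists (V `&` [set x | V x^-1]); split.
  - apply: openI => //; have /continuousP := @invg_continuous G; exact.
  - by split => //=; rewrite invg1.
  - by move=> x [/VV0].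
  - by move=> x [/= Vx Vx1]; split; rewrite //= invgK.
set S := [set divpow a pq.1 pq.2 | pq in [set: nat * nat]].
have cS := closure_monothetic_subgroup a; rewrite -/S in cS.
(* Some [a^(q - p)] is close to [x], and recurrence supplies [n > p] with [a^n] close to 1; the
   exponent [q - p + n] is then positive. *)
have reach x : closure S x -> exists2 m, (1 <= m)%N & V (x^-1 * a ^+ m).
  move=> Sx; have [|W1 [W2 [n1 n2 W12]]] := @mulg_cvg2 (x^-1 * x) 1 V.
    by rewrite mulg1 mulVg; exact: open_nbhs_nbhs.
  have [_ [[[p q] _ <-] Wpq]] := Sx _ (nbhs_ltranslation n1).
  have [n pn Wn] := ra _ n2 p.+1.
  exists (q + (n - p))%N; first by rewrite addn_gt0 subn_gt0 pn orbT.
  have -> : a ^+ (q + (n - p)) = divpow a p q * a ^+ n.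
    rewrite -!divpow0 divpowM; apply: divpow_eq; rewrite add0n addn0.
    by rewrite addnCA subnKC// ltnW.
  by rewrite mulgA; exact: W12.
have cQ : compact (V0 `&` closure S) by apply: compact_closedI => //; exact: cS.2.
have [J HJ] : exists J, forall x, V x -> closure S x ->
    exists j, [/\ (1 <= j)%N, (j <= J)%N & V (x^-1 * a ^+ j)].
  move: cQ; rewrite compact_cover => /(_ nat [set j | (1 <= j)%N]
    (fun j => [set x | V (x^-1 * a ^+ j)])) [].
  - move=> j _; suff /continuousP : continuous (fun x : G => x^-1 * a ^+ j) by apply.
    move=> x; apply: (@cvg_comp _ _ _ (fun x => x^-1) (fun x => x * a ^+ j) _ (nbhs x^-1)).
      exact: invg_continuous.
    exact: rtranslation_continuous.
  - by move=> x [_ /reach[m m1 Vm]]; exists m.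
  move=> D D1 HD; exists (\max_(j <- finmap.enum_fset D) j)%N => x Vx Sx.
  have [j /= jD Vj] := HD x (conj (VV0 _ Vx) Sx).
  exists j; split => //; first by have := D1 j jD; rewrite inE.
  exact: leq_bigmax_seq.
(* Let [x = a^(q - p)] and let [m >= 1] be least with [x^-1 a^m] in [V]. If [m > J], then [HJ] at
   the point [x^-1 a^m] gives [1 <= j <= J] with [a^(j - m) x] in [V]; by symmetry [x^-1 a^(m - j)]
   is in [V], against minimality. *)
have key p q : exists2 m, (m <= J)%N & V ((divpow a p q)^-1 * a ^+ m).
  have Sm p' q' : closure S (divpow a p' q') by apply: subset_closure; exists (p', q').
  have ex : exists m, (1 <= m)%N && `[< V ((divpow a p q)^-1 * a ^+ m) >].
    by have [m m1 Vm] := reach _ (Sm p q); exists m; rewrite m1; exact/asboolP.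
  case: (ex_minnP ex) => m /andP[m1 /asboolP Vm] mmin; exists m => //.
  rewrite leqNgt; apply/negP => Jm.
  move: Vm; rewrite divpowV -{1}divpow0 divpowM addn0 => Vm.
  have [j [j1 jJ]] := HJ _ Vm (Sm _ _).
  rewrite divpowV -divpow0 divpowM => /VV; rewrite divpowV => Vj.
  have := mmin (m - j)%N; rewrite subn_gt0 (leq_ltn_trans jJ Jm)/=.
  rewrite (_ : `[< _ >] = true); last first.
    apply/asboolP; rewrite divpowV -divpow0 divpowM.
    congr V: Vj; apply: divpow_eq; have := leq_ltn_trans jJ Jm; lia.
  move=> /(_ isT); rewrite leqNgt ltn_subrL j1 m1//.
(* By [key] this compact set contains all integer powers of [a]; being closed, it also contains
   their closure. *)
pose C := \big[setU/set0]_(m < J.+1) [set a ^+ m * y | y in V0].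
have cC : compact C.
  apply: bigsetU_compact => m _; apply: continuous_compact => //.
  by apply: continuous_subspaceT; exact: ltranslation_continuous.
have SC : closure S `<=` C.
  have /closure_id -> : closed C by exact: compact_closed.
  apply: closureS => _ [[p q] _ <-]; have [m mJ /VV] := key p q.
  rewrite invgM invgK => Vm; rewrite /C -(bigcup_mkord J.+1 (fun m => [set a ^+ m * y | y in V0])); exists m => //.
  by exists (a ^- m * divpow a p q); [exact: VV0|rewrite mulVKg].
apply: (subclosed_compact _ cC).
  by apply: closed_bigI => A [[_ cA] _].
apply: subset_trans SC; apply: smallest_sub => // _ ->; apply: subset_closure.
by exists (0, 1)%N => //; rewrite divpow0 expg1.
Qed.

(** If [K] met [K a^n] for arbitrarily large [n], infinitely many powers of [a] would lie in the
    compact set [K^-1 K]; [a] would then be recurrent and generate a compact group. *)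
Lemma aperiodic_escape a K : hausdorff_space G -> locally_compact [set: G] ->
  aperiodic a -> compact K ->
  exists N, forall n, (N <= n)%N -> forall x, K x -> ~ K (x * a ^+ n).
Proof.
move=> hG lG aa cK; apply: contrapT => nN; apply: aa.
apply: recurrent_compact => // V; apply: (@exp_recurrent _ [set x.1^-1 * x.2 | x in K `*` K]).
  apply: continuous_compact; last exact: compact_setX.
  apply: continuous_subspaceT => xy.
  apply: (@cvg_comp _ _ _ (fun xy : G * G => (xy.1^-1, xy.2)) (fun xy => xy.1 * xy.2) _ (nbhs (xy.1^-1, xy.2))).
    apply: cvg_pair => /=; last exact: cvg_snd.
    apply: (@cvg_comp _ _ _ fst (fun x : G => x^-1) _ (nbhs xy.1)); first exact: cvg_fst.
    exact: invg_continuous.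
  exact: (@mulg_continuous G (xy.1^-1, xy.2)).
move=> N; apply: contrapT => nN'; apply: nN; exists N => n Nn x Kx Kxa.
by apply: nN'; exists n => //; exists (x, x * a ^+ n) => //=; rewrite mulKg.
Qed.

End monothetic.

(** * Exhaustion by compact sets *)

Section sigma_compact.
Context (G : topologicalGroupType).

Lemma compact_borel (K : set G) : hausdorff_space G -> compact K ->
  measurable (K : set (borel G)).
Proof.
move=> hG cK; rewrite -[K]setCK; apply: measurableC; apply: borel_open.
by rewrite openC; exact: compact_closed.
Qed.

Lemma sigma_compact : locally_compact [set: G] -> @second_countable G ->
  exists K : nat -> set G, [/\ forall n, compact (K n),
    forall m n, (m <= n)%N -> K m `<=` K n & forall x, exists n, K n x].
Proof.
move=> lG [B cB [Bo Bb]].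
have BE x V : nbhs x V -> exists U, [/\ B U, U x & U `<=` V].
  by move=> /Bb[U [BU Ux] UV]; exists U.
have [f fB] : exists f : nat -> set G, B `<=` range f.
  move/pfcard_geP : cB => [B0|[f]].
    by have [U [+ _ _]] := BE 1%g _ filterT; rewrite B0.
  by exists f => U BU; have [n _ <-] := @surj _ _ _ _ f U BU; exists n.
(* Sets whose closure is not compact are discarded. The others still cover [G]: each point has a
   basic neighborhood inside a closed compact one. *)
pose C n := if `[< compact (closure (f n)) >] then closure (f n) else set0.
have cC n : compact (C n).
  by rewrite /C; case: asboolP => // _; exact: compact0.
exists (fun n => \big[setU/set0]_(i < n.+1) C i); split.
- by move=> n; apply: bigsetU_compact.
- by move=> m n mn; apply: subset_bigsetU.
move=> x; have [V + [cV clV]] := lG x I; rewrite withinET => Vx.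
have [_ [/fB[n _ <-] fx fV]] := BE _ _ Vx.
exists n; rewrite -bigcup_mkord; exists n => //=.
rewrite /C asboolT; first exact: subset_closure.
apply: (subclosed_compact _ cV); first exact: closed_closure.
by rewrite [V](closure_id _).1//; exact: closureS.
Qed.

End sigma_compact.

(** * Cocycles and multipliers *)

Section cocycle.
Context (G : topologicalGroupType) (R : realType) (a : G).
Implicit Types (W : G -> R) (x : G).

Definition cocycle W n x : R := \prod_(0 <= j < n) W (x * a ^- j)%g.

Lemma cocycle0 W x : cocycle W 0 x = 1.
Proof. by rewrite /cocycle big_nil. Qed.

Lemma cocycle1 W x : cocycle W 1 x = W x.
Proof. by rewrite /cocycle big_nat1 expg0 invg1 mulg1. Qed.

Lemma cocycleD W m n x : cocycle W (m + n) x = cocycle W m x * cocycle W n (x * a ^- m)%g.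
Proof.
rewrite /cocycle (@big_cat_nat _ _ _ m)//= ?leq_addr//; congr (_ * _).
rewrite -{1}[m]add0n big_addn addKn; apply: eq_bigr => j _.
by rewrite expgnDr invgM mulgA.
Qed.

Lemma cocycle_cst1 n x : cocycle (fun=> 1) n x = 1.
Proof. by rewrite /cocycle big1. Qed.

Lemma cocycle_gt0 W n x : (forall x, 0 < W x) -> 0 < cocycle W n x.
Proof. by move=> W0; apply: prodr_gt0. Qed.

Lemma varphitE W n x : varphit a W n x = (cocycle W n x)^-1.
Proof. by []. Qed.

(** The forward product at [x] is the backward product started at [x a^n], so one cocycle serves for
    both [varphi] and [varphit]. *)
Lemma varphiE W n x : varphi a W n x = cocycle W n (x * a ^+ n)%g.
Proof.
elim: n x => [|n IH] x; first by rewrite /varphi /cocycle !big_nil.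
rewrite -addn1 [in RHS]addnC cocycleD cocycle1 expg1 addn1.
rewrite /varphi big_nat_recr//= -/(varphi a W n x) IH mulrC; congr (_ * cocycle W n _).
by rewrite expgSr mulgA mulgK.
Qed.

Lemma cocycle_continuous W n : continuous W -> continuous (cocycle W n).
Proof.
move=> cW; elim: n => [|n IH].
  by rewrite (_ : cocycle W 0 = cst 1); [exact: cst_continuous|apply/funext => x; rewrite cocycle0].
have -> : cocycle W n.+1 = (fun x => cocycle W n x * W (x * a ^- n)%g).
  by apply/funext => x; rewrite -addn1 cocycleD cocycle1.
move=> x; apply: continuousM; first exact: IH.
apply: (@continuous_comp G G R (fun x => x * a ^- n)%g W); last exact: cW.
exact: rtranslation_continuous.
Qed.

End cocycle.

Section shift_ratio.
Context (G : topologicalGroupType) (R : realType) (a : G) (I : eqType).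
Variables (W : I -> G -> R) (rho : I -> nat).

(* For [A_i^n f x = cocycle (W i) (rho i * n) x * f (x a^(-rho i n))], the operator
   [A_i^n A_j^-n] multiplies by [shift_ratio i j n], then translates. *)
Definition shift_ratio i j n (x : G) : R :=
  cocycle a (W i) (rho i * n) (x * a ^- (rho j * n) * a ^+ (rho i * n))%g
  / cocycle a (W j) (rho j * n) x.

Hypothesis W_gt0 : forall i x, 0 < W i x.

Lemma shift_ratio_gt0 i j n x : 0 < shift_ratio i j n x.
Proof. by rewrite divr_gt0// cocycle_gt0. Qed.

(** The cocycle of [W i] of length [rho j * n] at [x] splits after [(rho j - rho i) * n] factors;
    the first piece cancels and the second is the numerator of the multiplier. *)
Lemma shift_ratio_ltE i j n x : (rho i <= rho j)%N ->
  shift_ratio i j n x = varphit a (W i) ((rho j - rho i) * n) x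
    * varphit a (W j) (rho j * n) x / varphit a (W i) (rho j * n) x.
Proof.
move=> ij; rewrite /shift_ratio !varphitE invrK mulrAC; congr (_ / _).
rewrite mulnBl; have le : (rho i * n <= rho j * n)%N by rewrite leq_mul2r ij orbT.
rewrite -{3}(subnK le) cocycleD mulrA mulVf ?gt_eqF ?cocycle_gt0// mul1r.
by congr cocycle; rewrite -{1}(subnKC le) expgnDr invgM mulgA mulgVK.
Qed.

(** Here the numerator itself splits: its first [(rho i - rho j) * n] factors form [varphi], and the
    remaining ones form a cocycle based at [x]. *)
Lemma shift_ratio_gtE i j n x : (rho j <= rho i)%N ->
  shift_ratio i j n x = varphi a (W i) ((rho i - rho j) * n) x
    * varphit a (W j) (rho j * n) x / varphit a (W i) (rho j * n) x.
Proof.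
move=> ji; rewrite /shift_ratio !varphitE varphiE invrK mulrAC; congr (_ / _).
rewrite mulnBl; have le : (rho j * n <= rho i * n)%N by rewrite leq_mul2r ji orbT.
have e : (x * a ^- (rho j * n) * a ^+ (rho i * n) = x * a ^+ (rho i * n - rho j * n))%g.
  by rewrite -{1}(subnKC le) expgnDr mulgA mulgVK.
rewrite e -{1}(subnK le) cocycleD; congr (_ * _); congr cocycle.
by rewrite mulgK.
Qed.

End shift_ratio.

Section extended_family.
Context (G : topologicalGroupType) (R : realType) (L : nat).
Variables (w : 'I_L -> weight G R) (r : 'I_L -> nat).

(* [None] is an extra index standing for the identity operator, so that the four
   families of products of the theorem become the single family [shift_ratio i j]
   with [i != j]. *)
Definition oweight (i : option 'I_L) : G -> R :=
  if i is Some l then w l else fun=> 1.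
Definition opower (i : option 'I_L) : nat := if i is Some l then r l else 0%N.

Lemma oweight_gt0 i x : 0 < oweight i x.
Proof. by case: i => [l|] //=; exact: weight_gt0. Qed.

Lemma oweight_continuous i : continuous (oweight i).
Proof. by case: i => [l|] /=; [exact: weight_continuous|exact: cst_continuous]. Qed.

Lemma shift_ratio_l0 a l n : shift_ratio a oweight opower (Some l) None n = varphi a (w l) (r l * n).
Proof.
apply/funext => x; rewrite shift_ratio_gtE// /= !varphitE mul0n !cocycle0.
by rewrite subn0 invr1 divr1 mulr1.
Qed.

Lemma shift_ratio_0l a l n : shift_ratio a oweight opower None (Some l) n = varphit a (w l) (r l * n).
Proof.
apply/funext => x; rewrite shift_ratio_ltE//= ?subn0; last exact: oweight_gt0.
by rewrite !varphitE !cocycle_cst1 invr1 divr1 mul1r.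
Qed.

(** The pairs [(l, None)] and [(None, l)] give the first two families of condition (ii), and
    [(s, l)] and [(l, s)] with [s < l] the two quotients. Since [P] is arbitrary, equality of the
    sequences of functions is all that is used. *)
Lemma shift_ratio_cvg_iff (a : G) (P : (nat -> G -> R) -> Prop) (n : nat -> nat)
    (r_increasing : forall s l : 'I_L, (s < l)%N -> (r s < r l)%N) :
  (forall i j, i != j -> P (fun k => shift_ratio a oweight opower i j (n k))) <->
  (forall l : 'I_L, P (fun k => varphi a (w l) (r l * n k)) /\
                    P (fun k => varphit a (w l) (r l * n k))) /\
  (forall s l : 'I_L, (s < l)%N ->
     P (fun k x => varphit a (w s) ((r l - r s) * n k) x * varphit a (w l) (r l * n k) x
                   / varphit a (w s) (r l * n k) x) /\
     P (fun k x => varphi a (w l) ((r l - r s) * n k) x * varphit a (w s) (r s * n k) x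
                   / varphit a (w l) (r s * n k) x)).
Proof.
have l0 l : (fun k => shift_ratio a oweight opower (Some l) None (n k)) =
    (fun k => varphi a (w l) (r l * n k)).
  by apply/funext => k; rewrite shift_ratio_l0.
have r0 l : (fun k => shift_ratio a oweight opower None (Some l) (n k)) =
    (fun k => varphit a (w l) (r l * n k)).
  by apply/funext => k; rewrite shift_ratio_0l.
have sl (s l : 'I_L) : (s < l)%N -> (fun k => shift_ratio a oweight opower (Some s) (Some l) (n k)) =
    (fun k x => varphit a (w s) ((r l - r s) * n k) x * varphit a (w l) (r l * n k) x
                   / varphit a (w s) (r l * n k) x).
  move=> /r_increasing/ltnW rsl; apply/funext => k; apply/funext => x.
  by rewrite shift_ratio_ltE//; exact: oweight_gt0.
have ls (s l : 'I_L) : (s < l)%N -> (fun k => shift_ratio a oweight opower (Some l) (Some s) (n k)) =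
    (fun k x => varphi a (w l) ((r l - r s) * n k) x * varphit a (w s) (r s * n k) x
                   / varphit a (w l) (r s * n k) x).
  move=> /r_increasing/ltnW rsl; apply/funext => k; apply/funext => x.
  by rewrite shift_ratio_gtE.
split=> [H|[H1 H2] [l|] [s|] //].
- split=> [l|s l lt]; first by rewrite -l0 -r0; split; exact: H.
  have ne : Some s != Some l by apply/eqP => -[e]; rewrite e ltnn in lt.
  by rewrite -sl// -ls//; split; apply: H; rewrite // eq_sym.
- move=> ne; have : l != s by apply: contra ne => /eqP ->.
  by rewrite -val_eqE /= neq_ltn => /orP[] lt; rewrite ?(sl _ _ lt) ?(ls _ _ lt);
    have [] := H2 _ _ lt.
- by move=> _; rewrite l0; have [] := H1 l.
- by move=> _; rewrite r0; have [] := H1 s.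
Qed.

End extended_family.

(** * Essential norms and almost everywhere bounds *)

Section ess_norm.
Context (G : topologicalGroupType) (R : realType).
Variable mu : {measure set (borel G) -> \bar R}.
Hypothesis mu0 : mu [set: borel G] != 0%E.

(** The norm of exponent [+oo] is an essential supremum once the whole space has positive measure,
    whence [mu0]. Off [E] the extended function is 0, which [c] bounds because it is nonnegative. *)
Lemma ess_norm_on_le (E : set G) (f : G -> R) (c : R) : 0 <= c ->
  (forall x, E x -> `|f x| <= c) -> (ess_norm_on mu E f <= c%:E)%E.
Proof.
move=> c0 fc; rewrite /ess_norm_on unlock lt_neqAle eq_sym mu0 measure_ge0 /=.
apply/ess_supP; apply: aeW => x /=; rewrite lee_fin patchE.
by case: ifPn => [/set_mem/fc//|_]; rewrite normr0.
Qed.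

Lemma ess_norm_on_ae (E : set G) (f : G -> R) (c : R) :
  (ess_norm_on mu E f <= c%:E)%E -> {ae mu, forall x, E x -> `|f x| <= c}.
Proof.
rewrite /ess_norm_on unlock lt_neqAle eq_sym mu0 measure_ge0 /= => /ess_supP.
apply: filterS => x /= + Ex; rewrite lee_fin patchE.
by rewrite mem_set.
Qed.

End ess_norm.

(** * Estimates in Orlicz spaces *)

Section trim.
Local Open Scope complex_scope.
Context (T : Type) (R : realType).
Local Notation C := (R[i]^o).
Implicit Types (f : T -> C) (A : set T).

(** Multiplication by the indicator, so that measurability and membership in the Orlicz space follow
    from the lemmas on products. *)
Definition trim A f : T -> C := fun x => (\1_A x : R)%:C * f x.

Lemma trim_in A f x : A x -> trim A f x = f x.
Proof. by move=> Ax; rewrite /trim indicE mem_set// mul1r. Qed.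

Lemma trim_out A f x : ~ A x -> trim A f x = 0.
Proof. by move=> Ax; rewrite /trim indicE memNset// mul0r. Qed.

Lemma normc_indic A x : normc ((\1_A x : R)%:C) <= 1.
Proof. by rewrite indicE; case: (_ \in _); rewrite ?normc1 ?normc0. Qed.

End trim.

Section orlicz_estimates.
Local Open Scope complex_scope.
Context d (T : measurableType d) (R : realType).
Variables (mu : {measure set T -> \bar R}) (Phi : young_function R).
Local Notation C := (R[i]^o).
Implicit Types (f : T -> C) (A : set T) (c t : R).

Lemma luxemburg_le f t : 0 < t ->
  (\int[mu]_x (Phi (t^-1 * normc (f x)))%:E <= 1)%E -> luxemburg mu Phi f <= t.
Proof.
move=> t0 ft; apply: ge_inf; first exact: luxemburg_has_lbound.
by split=> //; under eq_integral do rewrite mulrC.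
Qed.

(** A strict inequality provides an admissible scale below [t], and the modular decreases as the
    scale grows. *)
Lemma luxemburg_lt f t : 0 < t -> is_orlicz mu Phi f -> luxemburg mu Phi f < t ->
  (\int[mu]_x (Phi (t^-1 * normc (f x)))%:E <= 1)%E.
Proof.
move=> t0 Lf /(inf_lt (luxemburg_nonempty Lf))[k [k0 fk] kt].
have {}fk : (\int[mu]_x (Phi (k^-1 * normc (f x)))%:E <= 1)%E.
  by under eq_integral do rewrite mulrC.
apply: le_trans fk; apply: le_int_young.
- exact: Lf.1.
- exact: Lf.1.
- by rewrite invr_ge0 ltW.
- by move=> x; rewrite ler_wpM2r ?normc_ge0// lef_pV2// ltW.
Qed.

(** A Chebyshev inequality: where the modulus is at least [e], dividing it by [e * e] leaves at
    least [e^-1]. The bound [1 / Phi(1/e)] tends to 0 with [e]. *)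
Lemma luxemburg_tail f e : 0 < e -> is_orlicz mu Phi f -> luxemburg mu Phi f < e * e ->
  measurable [set x | e <= normc (f x)] /\
  (mu [set x | (e <= normc (f x))%R] <= ((Phi e^-1)^-1)%:E)%E.
Proof.
move=> e0 Lf fe; set D := [set x | _].
have mD : measurable D.
  rewrite (_ : D = [set: T] `&` [set x | (e%:E <= (EFin \o (fun x => normc (f x))) x)%E]).
    by apply: emeasurable_fun_c_infty => //; exact/measurable_EFinP/measurable_normc/Lf.1.
  by rewrite setTI; apply/seteqP; split=> x /=; rewrite lee_fin.
split=> //; have P0 : 0 < Phi e^-1 by rewrite young_gt0// invr_gt0.
rewrite -[leLHS]mul1e -(mulVf (lt0r_neq0 P0)) EFinM -muleA -[leRHS]mule1.
apply: lee_wpmul2l; first by rewrite lee_fin invr_ge0 ltW.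
apply: le_trans (luxemburg_lt (mulr_gt0 e0 e0) Lf fe).
rewrite -integral_cst//; apply: (@le_trans _ _
    (\int[mu]_(x in D) (Phi ((e * e)^-1 * normc (f x)))%:E)%E).
  apply: ge0_le_integral => //.
  - by move=> x _; rewrite lee_fin ltW.
  - by apply: measurable_funTS; apply: measurable_young_normc Lf.1.
  - move=> x /= Dx; rewrite lee_fin young_le//; first by rewrite invr_ge0 ltW.
    by rewrite invfM -mulrA -[leLHS]mulr1 ler_wpM2l ?invr_ge0 ?(ltW e0)// ler_pdivlMl// mulr1.
apply: ge0_subset_integral => //; first by apply: measurable_young_normc Lf.1.
by move=> x _; rewrite lee_fin young_ge0.
Qed.

Lemma modular_bounded f A c B : measurable A ->
  measurable_fun [set: T] (f : T -> borel C) -> 0 <= c ->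
  (forall x, A x -> normc (f x) <= B) -> (forall x, ~ A x -> f x = 0) ->
  (\int[mu]_x (Phi (c * normc (f x)))%:E <= (Phi (c * B))%:E * mu A)%E.
Proof.
move=> mA mf c0 fB f0; rewrite -integral_cst//.
rewrite [leRHS]integral_mkcond; apply: ge0_le_integral => //.
- by move=> x _; rewrite lee_fin young_ge0.
- exact: measurable_young_normc.
- by apply/(measurable_restrictT _ _).1.
- move=> x _; rewrite patchE; case: ifPn => [/set_mem Ax|/negP nA].
    by rewrite lee_fin young_le// ?mulr_ge0 ?normc_ge0// ler_wpM2l// fB.
  by rewrite f0 ?normc0 ?mulr0 ?young0// => Ax; apply: nA; exact: mem_set.
Qed.

Lemma is_orlicz_bounded f A B : measurable A -> (mu A < +oo)%E ->
  measurable_fun [set: T] (f : T -> borel C) ->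
  (forall x, A x -> normc (f x) <= B) -> (forall x, ~ A x -> f x = 0) ->
  is_orlicz mu Phi f.
Proof.
move=> mA Aoo mf fB f0; split=> //; exists 1 => //.
apply: le_lt_trans (modular_bounded mA mf ler01 fB f0) _.
by apply: lte_mul_pinfty => //; rewrite lee_fin young_ge0.
Qed.

Lemma luxemburg_bounded f A B t : measurable A ->
  measurable_fun [set: T] (f : T -> borel C) -> 0 < t ->
  (forall x, A x -> normc (f x) <= B) -> (forall x, ~ A x -> f x = 0) ->
  ((Phi (t^-1 * B))%:E * mu A <= 1)%E -> luxemburg mu Phi f <= t.
Proof.
move=> mA mf t0 fB f0 H; apply: luxemburg_le => //; apply: le_trans H.
by apply: modular_bounded => //; rewrite invr_ge0 ltW.
Qed.

(** Each use of the doubling condition doubles a scale at which the modular is finite, so every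
    scale [c] is eventually reached. *)
Lemma is_orlicz_scalable f c M : (forall t, 0 < t -> Phi (2 * t) <= M * Phi t) ->
  is_orlicz mu Phi f -> (\int[mu]_x (Phi (c * normc (f x)))%:E < +oo)%E.
Proof.
move=> D2 [mf [b b0 fb]].
have D2' t : 0 <= t -> Phi (2 * t) <= `|M| * Phi t.
  rewrite le_eqVlt => /predU1P[<-|t0]; first by rewrite mulr0 young0 mulr0.
  by rewrite (le_trans (D2 _ t0))// ler_wpM2r ?young_ge0// ler_norm.
have iter n : (\int[mu]_x (Phi (2 ^+ n * b * normc (f x)))%:E < +oo)%E.
  elim: n => [|n IH]; first by under eq_integral do rewrite expr0 mul1r.
  apply: (@le_lt_trans _ _ (`|M|%:E * \int[mu]_x (Phi (2 ^+ n * b * normc (f x)))%:E)%E).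
    rewrite -ge0_integralZl//; last 2 first.
    - exact: measurable_young_normc.
    - by move=> x _; rewrite lee_fin young_ge0.
    apply: ge0_le_integral => //.
    - by move=> x _; rewrite lee_fin young_ge0.
    - exact: measurable_young_normc.
    - by apply: measurable_funeM; exact: measurable_young_normc.
    - move=> x _; rewrite -EFinM lee_fin exprS -!mulrA D2'//.
      by rewrite !mulr_ge0// ?exprn_ge0 ?normc_ge0 ?(ltW b0).
  by apply: lte_mul_pinfty => //; rewrite lee_fin.
have [n cn] : exists n, `|c| <= 2 ^+ n * b.
  exists (Num.bound (`|c| / b)); rewrite -ler_pdivrMr//.
  rewrite (le_trans (ltW (archi_boundP _)))//; first by rewrite divr_ge0// ltW.
  by rewrite -natrX ler_nat ltnW// ltn_expl.
apply: le_lt_trans (iter n).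
rewrite (_ : (\int[mu]_x _)%E = (\int[mu]_x (Phi (`|c| * normc (f x)))%:E)%E).
  by apply: le_int_young => // x; rewrite ler_wpM2r// normc_ge0.
apply: eq_integral => x _; congr EFin.
by have [c0|c0] := ger0P c => //; rewrite mulNr young_even.
Qed.

Lemma measurable_trim A f : measurable A -> measurable_fun [set: T] (f : T -> borel C) ->
  measurable_fun [set: T] (trim A f : T -> borel C).
Proof.
move=> mA mf; apply: measurable_complexM => //; apply/measurable_complexP; split => /=.
  exact: measurable_indic.
exact: measurable_cst.
Qed.

Lemma is_orlicz_trim A f : measurable A -> is_orlicz mu Phi f -> is_orlicz mu Phi (trim A f).
Proof.
move=> mA Lf; apply: (@is_orliczM _ _ _ _ _ (fun x => (\1_A x : R)%:C) f 1) => //.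
  apply/measurable_complexP; split => /=; first exact: measurable_indic.
  exact: measurable_cst.
exact: normc_indic.
Qed.

(** Dominated convergence for the modular at scale [t]. The dominating function [Phi(|f|/t)] is
    integrable for every [t] by the doubling condition; once the modular is below 1, the norm is at
    most [t]. *)
Lemma luxemburg_trim_cvg (A : nat -> set T) f M t :
  (forall t, 0 < t -> Phi (2 * t) <= M * Phi t) ->
  (forall n, measurable (A n)) -> (forall x, \forall n \near \oo, A n x) ->
  is_orlicz mu Phi f -> 0 < t ->
  \forall n \near \oo, luxemburg mu Phi (trim (A n) f - f) <= t.
Proof.
move=> D2 mA Ax Lf t0.
have mfA n : measurable_fun [set: T] ((trim (A n) f - f) : T -> borel C).
  have -> : trim (A n) f - f = (fun x => ((\1_(A n) x : R)%:C - 1) * f x).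
    by apply/funext => x; rewrite mulrBl mul1r.
  apply: measurable_complexM Lf.1; apply/measurable_complexP; split => /=.
    by apply: measurable_funB => //; exact: measurable_indic.
  by rewrite (_ : (fun=> _) = cst 0)//; apply/funext => x; rewrite /= subrr.
have := @dominated_convergence _ _ _ mu setT measurableT
  (fun n x => (Phi (t^-1 * normc ((trim (A n) f - f) x)))%:E) (cst 0%E)
  (fun x => (Phi (t^-1 * normc (f x)))%:E).
case.
- by move=> n; exact: measurable_young_normc.
- exact: measurable_cst.
- apply: aeW => x _; apply: cvg_near_cst; near=> n.
  have Anx : A n x by near: n; exact: Ax.
  by rewrite -[X in normc X]/(trim (A n) f x - f x) trim_in// subrr normc0 mulr0 young0.
- apply/integrableP; split; first exact: measurable_young_normc Lf.1.
  under eq_integral do rewrite gee0_abs ?lee_fin ?young_ge0//.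
  exact: is_orlicz_scalable D2 Lf.
- apply: aeW => x n _ /=; rewrite lee_fin ger0_norm ?young_ge0//.
  rewrite young_le ?mulr_ge0 ?normc_ge0 ?invr_ge0 ?(ltW t0)// ler_wpM2l ?invr_ge0 ?(ltW t0)//.
  rewrite -[X in normc X]/(trim (A n) f x - f x).
  have [An|An] := pselect (A n x); first by rewrite trim_in// subrr normc0 normc_ge0.
  by rewrite trim_out// sub0r normcN.
move=> _ _; rewrite integral_cst// mul0e => cv.
have : nbhs (0 : \bar R)%E [set y | (y < 1)%E].
  by apply: open_nbhs_nbhs; split; [exact: open_ereal_lt_ereal|rewrite /= lte01].
move=> /cv h; near=> n; apply: luxemburg_le => //; apply/ltW; near: n; exact: h.
Unshelve. all: by end_near. Qed.

End orlicz_estimates.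

(** * Iterates of weighted translations *)

Section operators.
Local Open Scope complex_scope.
Context (G : topologicalGroupType) (R : realType).
Variables (lambda : right_haar_measure G R) (Phi : young_function R) (a : G).
Local Notation C := (R[i]^o).

Definition shift_mul (W : G -> R) n (f : G -> C) : G -> C :=
  fun x => (cocycle a W n x)%:C * f (x * a ^- n)%g.

(** The iterate of a class receives a representative given by an exact formula, so that later
    computations are pointwise identities of functions. *)
Lemma iter_weighted_translation (w : weight G R) n (f : orlicz_fun lambda Phi) :
  exists2 g : orlicz_fun lambda Phi,
    iter n (weighted_translation lambda Phi a w) (orlicz_class f) = orlicz_class g &
    (g : G -> C) = shift_mul w n f.
Proof.
elim: n => [|n [g IH gE]].
  exists f => //; apply/funext => x.
  by rewrite /shift_mul cocycle0 mul1r expg0 invg1 mulg1.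
exists (weighted_translation_orlicz a w g).
  by rewrite iterS IH weighted_translation_class.
apply/funext => x; rewrite /= /weighted_translation_fun gE /shift_mul.
by rewrite mulrA -rmorphM -add1n cocycleD cocycle1 expg1 add1n expgSr invgM mulgA.
Qed.

Variables (L : nat) (w : 'I_L -> weight G R) (r : 'I_L -> nat).
Local Notation T := (fun l : 'I_L => iter (r l) (weighted_translation lambda Phi a (w l))).

Definition oop (i : option 'I_L) : orlicz_space lambda Phi -> orlicz_space lambda Phi :=
  if i is Some l then T l else id.

Lemma iter_oop n i (f : orlicz_fun lambda Phi) :
  exists2 g : orlicz_fun lambda Phi,
    iter n (oop i) (orlicz_class f) = orlicz_class g &
    (g : G -> C) = shift_mul (oweight w i) (opower r i * n) f.
Proof.
case: i => [l|] /=.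
  by rewrite mulnC -iterM; exact: iter_weighted_translation.
exists f; first by elim: n => //= n ->.
apply/funext => x; rewrite /shift_mul cocycle_cst1 mul0n mul1r expg0 invg1 mulg1 //.
Qed.

Lemma orlicz_dist (f g : orlicz_fun lambda Phi) :
  `|orlicz_class f - orlicz_class g| = (luxemburg lambda Phi ((f : G -> C) - g))%:C.
Proof.
have -> : orlicz_class f - orlicz_class g = orlicz_class (f - g).
  by apply/eqP; rewrite subr_eq -orlicz_classD subrK.
by rewrite orlicz_normE orlicz_norm_class.
Qed.

Lemma orlicz_ballE (f g : orlicz_fun lambda Phi) (e : R) :
  ball (orlicz_class f) e%:C (orlicz_class g) <->
  luxemburg lambda Phi ((g : G -> C) - f) < e.
Proof. by rewrite -ball_normE /ball_ /= distrC orlicz_dist ltcR. Qed.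

(** Disjoint transitivity in terms of the norm: [f None] plays the role of a point of [U], and
    [f (Some l)] that of a point of [V l]. *)
Definition joint_approximation :=
  forall (f : option 'I_L -> orlicz_fun lambda Phi) (e : R), 0 < e ->
  exists2 n, (1 <= n)%N & exists v : orlicz_fun lambda Phi, forall i,
    luxemburg lambda Phi (shift_mul (oweight w i) (opower r i * n) v - f i) < e.

Lemma disjoint_transitiveP : disjoint_topologically_transitive T <-> joint_approximation.
Proof.
split=> [H f e e0|H U V oU [u0 Uu0] oV V0].
  have e0' : 0 < e%:C by rewrite ltcR.
  have [||||n n1 [u [Uu Vu]]] := H (ball (orlicz_class (f None)) e%:C)
      (fun l => ball (orlicz_class (f (Some l))) e%:C).
  - exact: ball_open.
  - by exists (orlicz_class (f None)); exact: ballxx.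
  - by move=> l; exact: ball_open.
  - by move=> l; exists (orlicz_class (f (Some l))); exact: ballxx.
  exists n => //; exists (orlicz_repr u) => i.
  have [g + gE] := iter_oop n i (orlicz_repr u); rewrite orlicz_reprK -gE => gu.
  apply/orlicz_ballE; rewrite -gu; case: i {g gE gu} => [l|]; first exact: (Vu l I).
  by rewrite [iter _ _ _](_ : _ = u)//; elim: n {n1 Vu} => //= n ->.
pose O (i : option 'I_L) := if i is Some l then V l else U.
have [c Oc] : {c & forall i, O i (orlicz_class (c i : orlicz_fun lambda Phi))}.
  apply: (@choice _ _ (fun i c => O i (orlicz_class c))) => -[l|].
    by have [v Vv] := V0 l; exists (orlicz_repr v); rewrite orlicz_reprK.
  by exists (orlicz_repr u0); rewrite orlicz_reprK.
have oO i : open (O i) by case: i.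
(* There are finitely many indices, so a single radius serves all the open sets. Radii in this
   normed module are positive elements of [R[i]], hence real. *)
have : \forall e \near 0^'+, forall i, ball (orlicz_class (c i)) (e : R)%:C `<=` O i.
  apply: filter_forall => i.
  have /nbhs_ballP[e /= e0 eO] : nbhs (orlicz_class (c i)) (O i) by exact: open_nbhs_nbhs.
  have re : (complex.Re e)%:C = e by apply: RRe_real; exact: gtr0_real.
  have Re0 : 0 < complex.Re e by rewrite -ltcR re.
  near=> t; apply: subset_trans eO; apply: le_ball; rewrite -re lecR.
  by near: t; exact: nbhs_right_le.
move=> near_e; near (0 : R)^'+ => e.
have e0 : 0 < e by [].
have eO : forall i, ball (orlicz_class (c i)) e%:C `<=` O i by near: e; exact: near_e.
have [n n1 [v vc]] := H c e e0.
have Ov i : O i (iter n (oop i) (orlicz_class v)).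
  have [g -> gE] := iter_oop n i v; apply: eO; apply/orlicz_ballE.
  by rewrite gE.
exists n => //; exists (orlicz_class v); split.
  by have := Ov None; rewrite /= [iter _ _ _](_ : _ = orlicz_class v)//; elim: n {n1 vc Ov} => //= n ->.
by move=> l _; exact: (Ov (Some l)).
Unshelve. all: by end_near. Qed.

End operators.

(** * Sets on which all multipliers are small *)

Section good_sets.
Context (G : topologicalGroupType) (R : realType).
Variables (lambda : right_haar_measure G R) (a : G) (I : finType).
Variables (W : I -> G -> R) (rho : I -> nat).
Hypothesis W_gt0 : forall i x, 0 < W i x.
Hypothesis G_hausdorff : hausdorff_space G.

(** One stage of condition (ii): a single tolerance controls the lost measure and the multipliers,
    and the latter are bounded at every point of [E], not just almost everywhere. *)
Definition small_ratios (K : set G) (N : nat) (e : R) :=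
  exists n (E : set G), [/\ (N <= n)%N, measurable (E : set (borel G)), E `<=` K,
    (lambda (K `\` E) <= e%:E)%E &
    forall i j, i != j -> forall x, E x -> shift_ratio a W rho i j n x <= e].

Definition ratios_cvg0 (K : set G) :=
  exists (E : nat -> set (borel G)) (n : nat -> nat),
    [/\ forall k, measurable (E k) /\ E k `<=` K,
        lambda (E k) @[k --> \oo] --> lambda K,
        forall k, (1 <= n k)%N,
        forall i j, (i < j)%N -> (n i < n j)%N &
        forall i j, i != j ->
          ess_norm_on lambda (E k) (shift_ratio a W rho i j (n k)) @[k --> \oo] --> 0%E].

Let sube_subK (x y : \bar R) : x \is a fin_num -> y \is a fin_num ->
  (x - (x - y) = y)%E.
Proof. by move=> /fineK <- /fineK <-; rewrite -!EFinB subKr. Qed.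

Lemma haar_setT_neq0 : lambda [set: borel G] != 0%E.
Proof. by have [] := haar_measureP lambda. Qed.

Lemma haar_compact_lty (K : set G) : compact K -> (lambda K < +oo)%E.
Proof. by have [_ + _ _ _] := haar_measureP lambda; apply. Qed.

(** A far enough stage of the sequences satisfies the finitely many bounds almost everywhere;
    removing a null set from it makes them hold everywhere. *)
Lemma ratios_cvg0_small K e : compact K -> 0 < e ->
  ratios_cvg0 K -> small_ratios K 1 e.
Proof.
move=> cK e0 [E [n [mE EK n1 _ Er]]].
have mK := compact_borel G_hausdorff cK.
have Kfin : lambda K \is a fin_num by rewrite ge0_fin_numE// haar_compact_lty.
have near1 : \forall k \near \oo, (lambda K - e%:E < lambda (E k))%E.
  suff /EK : nbhs (lambda K) [set y | (lambda K - e%:E < y)%E] by [].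
  apply: open_nbhs_nbhs; split; first exact: open_ereal_gt_ereal.
  by rewrite /mkset lteBlDr// lteDl// lte_fin.
have near2 : \forall k \near \oo, forall ij : I * I, ij.1 != ij.2 ->
    (ess_norm_on lambda (E k) (shift_ratio a W rho ij.1 ij.2 (n k)) < e%:E)%E.
  apply: filter_forall => -[i j] /=; have [->|ij] := eqVneq i j; first by apply: nearW => k /eqP.
  have n0 : nbhs (0 : \bar R)%E [set y | (y < e%:E)%E]; last first.
    by have := Er i j ij _ n0; near_simpl => near_r; near=> k => _; near: k; exact: near_r.
  apply: open_nbhs_nbhs; split; first exact: open_ereal_lt_ereal.
  by rewrite /= lte_fin.
have [k [k1 k2]] : exists k, (lambda K - e%:E < lambda (E k))%E /\
    forall ij : I * I, ij.1 != ij.2 ->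
    (ess_norm_on lambda (E k) (shift_ratio a W rho ij.1 ij.2 (n k)) < e%:E)%E.
  near \oo => k; exists k; split; near: k; [exact: near1|exact: near2].
have [mEk EkK] := mE k.
have : {ae lambda, forall x, forall ij : I * I, ij.1 != ij.2 -> E k x ->
    `|shift_ratio a W rho ij.1 ij.2 (n k) x| <= e}.
  apply: filter_forall => ij; have [eij|ij'] := eqVneq ij.1 ij.2.
    by apply: aeW => x.
  have := ess_norm_on_ae haar_setT_neq0 (ltW (k2 ij ij')).
  by apply: (@filterS _ _ (ae_filter_ringOfSetsType lambda)) => x H _.
move=> [N [mN N0 HN]].
have mEN : measurable ((E k `\` N) : set (borel G)) by exact: measurableD.
exists (n k), (E k `\` N); split => //.
- by move=> x [/EkK].
- have -> : lambda (K `\` (E k `\` N)) = (lambda K - lambda (E k))%E.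
    rewrite measureD//; last exact: haar_compact_lty.
    congr (_ - _)%E; rewrite (_ : K `&` _ = E k `\` N); last first.
      by apply/seteqP; split=> [x []//|x [/[dup] /EkK]].
    rewrite measureD//; last by apply: le_lt_trans (haar_compact_lty cK); apply: le_measure; rewrite ?inE.
    rewrite [X in (_ - X)%E](_ : _ = 0%E) ?sube0//.
    by apply/eqP; rewrite -measure_le0 -N0 le_measure ?inE//; exact: measurableI.
  rewrite leeBlDr; last first.
    by rewrite ge0_fin_numE//; apply: le_lt_trans (haar_compact_lty cK); apply: le_measure; rewrite ?inE.
  by rewrite addeC -leeBlDr// ltW.
- move=> i j ij x [Ex nNx]; apply: contrapT => H; apply: nNx; apply: HN => /= H'.
  by apply: H; rewrite -[leLHS]gtr0_norm ?shift_ratio_gt0//; exact: (H' (i, j)).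
Unshelve. all: by end_near. Qed.

Lemma small_ratios_cvg0 K : compact K ->
  (forall N e, 0 < e -> small_ratios K N e) -> ratios_cvg0 K.
Proof.
move=> cK H.
have mK := compact_borel G_hausdorff cK.
have Kfin : lambda K \is a fin_num by rewrite ge0_fin_numE// haar_compact_lty.
have /choice[F FP] : forall kN : nat * nat, exists nE : nat * set G,
    [/\ (kN.2 <= nE.1)%N, measurable (nE.2 : set (borel G)), nE.2 `<=` K,
    (lambda (K `\` nE.2) <= (harmonic kN.1)%:E)%E &
    forall i j, i != j -> forall x, nE.2 x -> shift_ratio a W rho i j nE.1 x <= harmonic kN.1].
  by move=> [k N]; have [n [E ?]] := H N (harmonic k) (harmonic_gt0 _); exists (n, E).
(* Stage [k] has tolerance [1 / (k + 1)], and its exponent is required to exceed that of the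
   previous stage, which makes [n] strictly increasing. *)
pose s := fix s k := if k is k'.+1 then F (k, (s k').1.+1) else F (0, 1)%N.
have sP k : exists N, (1 <= N)%N /\ s k = F (k, N).
  by case: k => [|k]; [exists 1%N|exists (s k).1.+1].
have {}sP k : [/\ (1 <= (s k).1)%N, measurable ((s k).2 : set (borel G)), (s k).2 `<=` K,
    (lambda (K `\` (s k).2) <= (harmonic k)%:E)%E &
    forall i j, i != j -> forall x, (s k).2 x -> shift_ratio a W rho i j (s k).1 x <= harmonic k].
  have [N [N1 ->]] := sP k; have [Nn ? ? ? ?] := FP (k, N).
  by split => //; exact: leq_trans Nn.
exists (fun k => (s k).2), (fun k => (s k).1); split.
- by move=> k; have [] := sP k.
- have -> : (fun k => lambda (s k).2) = (fun k => lambda K - lambda (K `\` (s k).2))%E.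
    apply/funext => k; have [_ mE EK _ _] := sP k.
    rewrite measureD//; last exact: haar_compact_lty.
    rewrite (_ : K `&` _ = (s k).2); last by apply/seteqP; split=> [x []//|x /[dup] /EK].
    have Efin : lambda (s k).2 \is a fin_num.
      by rewrite ge0_fin_numE//; apply: le_lt_trans (haar_compact_lty cK); apply: le_measure; rewrite ?inE.
    exact/esym/sube_subK.
  rewrite -[X in _ --> X]sube0; apply: cvgeB; first by rewrite fin_num_adde_defl.
    exact: cvg_cst.
  apply: (@squeeze_cvge _ _ _ _ (cst 0%E) _ (fun k => (harmonic k)%:E)).
  + by near=> k; rewrite measure_ge0 /=; have [] := sP k.
  + exact: cvg_cst.
  + exact: cvge_harmonic.
- by move=> k; have [] := sP k.
- apply: (@homo_ltn nat (fun k => (s k).1) (fun x y => (x < y)%N)) => [y x z|k]; first exact: ltn_trans.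
  by have [/= + _ _ _ _] := FP (k.+1, (s k).1.+1).
- move=> i j ij; apply: (@squeeze_cvge _ _ _ _ (cst 0%E) _ (fun k => (harmonic k)%:E)).
  + near=> k; rewrite Lnorm_ge0 /=; apply: ess_norm_on_le; first exact: haar_setT_neq0.
      exact: harmonic_ge0.
    move=> x Ex; rewrite gtr0_norm ?shift_ratio_gt0//; have [_ _ _ _ Hr] := sP k.
    exact: Hr.
  + exact: cvg_cst.
  + exact: cvge_harmonic.
Unshelve. all: by end_near. Qed.

End good_sets.

Section orlicz_sum.
Local Open Scope complex_scope.
Context d (T : measurableType d) (R : realType).
Variables (mu : {measure set T -> \bar R}) (Phi : young_function R).
Local Notation C := (R[i]^o).

Lemma luxemburg_sum (I : Type) (s : seq I) (F : I -> T -> C) :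
  (forall i, is_orlicz mu Phi (F i)) -> is_orlicz mu Phi (\sum_(i <- s) F i) /\
  luxemburg mu Phi (\sum_(i <- s) F i) <= \sum_(i <- s) luxemburg mu Phi (F i).
Proof.
move=> LF; elim: s => [|i s [Ls IH]].
  by rewrite !big_nil luxemburg0; split=> //; exact: is_orlicz0.
rewrite !big_cons; split; first exact: is_orliczD.
by apply: le_trans (luxemburgD (LF i) Ls) _; rewrite lerD2l.
Qed.

End orlicz_sum.

(** * Small multipliers imply transitivity *)

Section sufficiency.
Local Open Scope complex_scope.
Context (G : topologicalGroupType) (R : realType).
Variables (lambda : right_haar_measure G R) (Phi : young_function R) (a : G).
Variables (L : nat) (w : 'I_L -> weight G R) (r : 'I_L -> nat).
Hypothesis G_hausdorff : hausdorff_space G.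
Local Notation C := (R[i]^o).
Local Notation W := (oweight w).
Local Notation rho := (opower r).
Local Notation ratio i j n := (shift_ratio a W rho i j n).

(** The operator [A_i^n A_j^-n]; for [i = None] it is [A_j^-n]. Multiplier and function are
    evaluated at the same translated point, so a bound of the multiplier on [E] controls the image
    of any function vanishing off [E]. *)
Definition transfer i j n (g : G -> C) : G -> C := fun x =>
  (ratio i j n (x * a ^- (rho i * n) * a ^+ (rho j * n))%g)%:C
  * g (x * a ^- (rho i * n) * a ^+ (rho j * n))%g.

Lemma shift_mul_transfer i j n g :
  shift_mul a (W i) (rho i * n) (transfer None j n g) = transfer i j n g.
Proof.
apply/funext => x; rewrite /shift_mul /transfer mulrA -rmorphM /=.
rewrite mul0n expg0 invg1 mulg1; congr (_%:C * _).
by rewrite /shift_ratio /= cocycle_cst1 mul1r mulgK mulgVK.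
Qed.

Lemma transfer_id i n g : transfer i i n g = g.
Proof.
apply/funext => x; rewrite /transfer /shift_ratio !mulgVK divff ?mul1r//.
by rewrite gt_eqF// cocycle_gt0//; exact: oweight_gt0.
Qed.

Lemma shift_mul_sum (I : finType) V n (F : I -> G -> C) :
  shift_mul a V n (\sum_i F i) = \sum_i shift_mul a V n (F i).
Proof.
apply/funext => x; rewrite /shift_mul !fct_sumE mulr_sumr.
by [].
Qed.

Lemma translation_continuous2 (b c : G) : continuous (fun x : G => x * b * c)%g.
Proof.
move=> x; apply: (@continuous_comp G G G (fun x => x * b)%g (fun x => x * c)%g);
  exact: rtranslation_continuous.
Qed.

Lemma shift_ratio_continuous i j n : continuous (ratio i j n).
Proof.
have cn : continuous (fun x => cocycle a (W i) (rho i * n) (x * a ^- (rho j * n) * a ^+ (rho i * n))%g).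
  move=> x; apply: (@continuous_comp G G R (fun x => x * _ * _)%g (cocycle a (W i) (rho i * n))).
    exact: translation_continuous2.
  by apply: cocycle_continuous; exact: oweight_continuous.
have cd : continuous (fun x => (cocycle a (W j) (rho j * n) x)^-1).
  move=> x; apply: continuousV; last by apply: cocycle_continuous; exact: oweight_continuous.
  by rewrite gt_eqF// cocycle_gt0//; exact: oweight_gt0.
by move=> x; exact: (continuousM (cn x) (cd x)).
Qed.

Lemma measurable_transfer i j n (g : G -> C) :
  measurable_fun [set: borel G] (g : borel G -> borel C) ->
  measurable_fun [set: borel G] (transfer i j n g : borel G -> borel C).
Proof.
move=> mg; have mt : measurable_fun [set: borel G]
    ((fun x : G => x * a ^- (rho i * n) * a ^+ (rho j * n))%g : borel G -> borel G).
  by apply: borel_continuous; exact: translation_continuous2.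
apply: measurable_complexM; last exact: (measurableT_comp mg mt).
apply/measurable_complexP; split => /=; last exact: measurable_cst.
apply: (measurableT_comp _ mt); apply: borel_continuous_real.
exact: shift_ratio_continuous.
Qed.

(** The image is bounded by [c * B] and vanishes off a translate of [E], whose measure is that of
    [E] by right invariance. *)
Lemma transfer_bound i j n (E : set G) (h : G -> C) (B c t : R) :
  measurable (E : set (borel G)) -> (lambda E < +oo)%E ->
  measurable_fun [set: borel G] (h : borel G -> borel C) ->
  0 <= B -> (forall x, normc (h x) <= B) ->
  (forall x, E x -> ratio i j n x <= c) ->
  is_orlicz lambda Phi (transfer i j n (trim E h)) /\
  (0 < t -> ((Phi (t^-1 * (c * B)))%:E * lambda E <= 1)%E ->
     luxemburg lambda Phi (transfer i j n (trim E h)) <= t).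
Proof.
move=> mE Eoo mh B0 hB rc.
pose tr x : G := (x * a ^- (rho i * n) * a ^+ (rho j * n))%g.
have trE : tr @^-1` E = (fun x => x * a ^- (rho i * n))%g @^-1`
    ((fun x => x * a ^+ (rho j * n))%g @^-1` E) by [].
have mE1 : measurable ((fun x : G => x * a ^+ (rho j * n))%g @^-1` E : set (borel G)).
  by rewrite -[X in measurable X]setTI; exact: measurable_rtranslation.
have mA : measurable (tr @^-1` E : set (borel G)).
  by rewrite trE -[X in measurable X]setTI; exact: measurable_rtranslation.
have lA : lambda (tr @^-1` E) = lambda E by rewrite trE !haar_rtranslation.
have mU : measurable_fun [set: borel G] (transfer i j n (trim E h) : borel G -> borel C).
  by apply: measurable_transfer; exact: measurable_trim.
have U1 x : (tr @^-1` E) x -> normc (transfer i j n (trim E h) x) <= c * B.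
  move=> Ex; rewrite /transfer normcM normc_real trim_in//.
  rewrite gtr0_norm; last by apply: shift_ratio_gt0; exact: oweight_gt0.
  apply: ler_pM => //; last exact: rc.
    by apply/ltW/shift_ratio_gt0; exact: oweight_gt0.
  exact: normc_ge0.
have U0 x : ~ (tr @^-1` E) x -> transfer i j n (trim E h) x = 0.
  by move=> Ex; rewrite /transfer trim_out// mulr0.
split=> [|t0 H]; first by apply: (is_orlicz_bounded _ mA _ mU U1 U0); rewrite lA.
by apply: (luxemburg_bounded mA mU t0 U1 U0); rewrite lA.
Qed.

(** The error at index [i] is a finite sum: the diagonal term is [h i] cut off from [E], supported
    in the small set [K \ E]; the others have small values on a set no larger than [K]. *)
Lemma bounded_approximation (K : set G) (h : option 'I_L -> G -> C) (B e : R) :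
  compact K -> 0 <= B -> 0 < e ->
  (forall i, measurable_fun [set: borel G] (h i : borel G -> borel C)) ->
  (forall i x, normc (h i x) <= B) -> (forall i x, ~ K x -> h i x = 0) ->
  (forall e, 0 < e -> small_ratios lambda a W rho K 1 e) ->
  exists2 n, (1 <= n)%N & exists2 v : G -> C, is_orlicz lambda Phi v &
    forall i, luxemburg lambda Phi (shift_mul a (W i) (rho i * n) v - h i) <= e.
Proof.
move=> cK B0 e0 mh hB h0 small.
have mK := compact_borel G_hausdorff cK.
have Koo := haar_compact_lty lambda cK.
have Kfin : lambda K \is a fin_num by rewrite ge0_fin_numE.
(* The tolerance [e] is shared equally among the indices. *)
pose t := e / #|{: option 'I_L}|%:R.
have I0 : 0 < #|{: option 'I_L}|%:R :> R by rewrite ltr0n card_option.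
have t0 : 0 < t by rewrite divr_gt0.
pose s := Phi (t^-1 * B); have s0 : 0 <= s by exact: young_ge0.
pose q := fine (lambda K); have q0 : 0 <= q by rewrite fine_ge0.
(* With this [c], [s * c <= 1] handles the diagonal term. For the others, [s * c * q <= 1] suffices,
   as [c <= 1] and convexity give [Phi(c B / t) <= c Phi(B / t)]. *)
pose c := ((1 + s) * (1 + q))^-1.
have s1 : 1 <= 1 + s by rewrite lerDl.
have q1 : 1 <= 1 + q by rewrite lerDl.
have p0 : 0 < (1 + s) * (1 + q) by rewrite mulr_gt0// (lt_le_trans ltr01).
have c0 : 0 < c by rewrite invr_gt0.
have c1 : c <= 1 by rewrite invf_le1// mulr_ege1.
have sc : s * c <= 1.
  by rewrite ler_pdivrMr// mul1r; nra.
have scq : s * c * q <= 1.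
  by rewrite mulrAC ler_pdivrMr// mul1r; nra.
have [n [E [n1 mE EK KE rE]]] := small c c0.
have Eoo : (lambda E < +oo)%E by apply: le_lt_trans Koo; apply: le_measure; rewrite ?inE.
exists n => //.
have Lh i : is_orlicz lambda Phi (h i).
  exact: (is_orlicz_bounded Phi mK Koo (mh i) (fun x _ => hB i x) (h0 i)).
have Lu i j : is_orlicz lambda Phi (transfer i j n (trim E (h j))).
  have [<-|ij] := eqVneq i j.
    by rewrite transfer_id; exact: is_orlicz_trim.
  have rij := rE i j ij.
  by have [] := transfer_bound 1 mE Eoo (mh j) B0 (hB j) rij.
exists (\sum_j transfer None j n (trim E (h j))); first exact: (luxemburg_sum _ _).1.
move=> i; rewrite shift_mul_sum.
under eq_bigr do rewrite shift_mul_transfer.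
pose F j := if j == i then trim E (h i) - h i else transfer i j n (trim E (h j)).
have LF j : is_orlicz lambda Phi (F j) /\ luxemburg lambda Phi (F j) <= t.
  rewrite /F; have [_|ji] := eqVneq j i.
    have mcut : measurable_fun [set: borel G] ((trim E (h i) - h i) : borel G -> borel C).
      have -> : trim E (h i) - h i = trim E (h i) + (fun x => (-1) * h i x).
        by apply/funext => x; rewrite -[RHS]/(trim E (h i) x + -1 * h i x) mulN1r.
      apply: measurable_complexD; first exact: measurable_trim.
      by apply: measurable_complexM => //; exact: measurable_complex_cst.
    have mKE : measurable ((K `\` E) : set (borel G)) by exact: measurableD.
    have b1 x : (K `\` E) x -> normc ((trim E (h i) - h i) x) <= B.
      move=> [_ nE]; rewrite -[X in normc X]/(trim E (h i) x - h i x).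
      by rewrite trim_out// sub0r normcN.
    have b0 x : ~ (K `\` E) x -> (trim E (h i) - h i) x = 0.
      move=> nKE; rewrite -[LHS]/(trim E (h i) x - h i x).
      have [Ex|nE] := pselect (E x); first by rewrite trim_in// subrr.
      by rewrite trim_out// h0 ?subrr// => Kx; apply: nKE.
    split.
      apply: (is_orlicz_bounded _ mKE _ mcut b1 b0).
      by apply: le_lt_trans Koo; apply: le_measure; rewrite ?inE//; exact: subDsetl.
    apply: (luxemburg_bounded mKE mcut t0 b1 b0).
    apply: (@le_trans _ _ (s%:E * c%:E)%E); first by rewrite lee_wpmul2l ?lee_fin.
    by rewrite -EFinM lee_fin.
  have ij : i != j by rewrite eq_sym.
  have rij := rE i j ij.
  have [LU] := transfer_bound t mE Eoo (mh j) B0 (hB j) rij.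
  move=> /(_ t0) H; split=> //; apply: H.
  apply: (@le_trans _ _ ((s * c)%:E * q%:E)%E); last by rewrite -EFinM lee_fin.
  apply: lee_pmul; rewrite ?lee_fin ?young_ge0//; last first.
    by rewrite fineK//; apply: le_measure; rewrite ?inE.
  rewrite mulrCA [leRHS]mulrC; exact: young_scale (ltW c0) c1.
have -> : \sum_j transfer i j n (trim E (h j)) - h i = \sum_j F j.
  rewrite (bigD1 i)//= [RHS](bigD1 i)//= {1}/F eqxx transfer_id addrAC; congr (_ + _).
  by apply: eq_bigr => j /negPf ji; rewrite /F ji.
apply: le_trans (luxemburg_sum _ (fun j => (LF j).1)).2 _.
apply: (@le_trans _ _ (\sum_(j : option 'I_L) t)); first by apply: ler_sum => j _; exact: (LF j).2.
by rewrite sumr_const -mulr_natr mulfVK// gt_eqF.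
Qed.

End sufficiency.

(** Each target is first truncated to a compact set on which its modulus is at most [m], and the
    truncations are then approximated jointly. *)
Lemma small_ratios_approximation (G : topologicalGroupType) (R : realType)
    (lambda : right_haar_measure G R) (Phi : young_function R) (a : G)
    (L : nat) (w : 'I_L -> weight G R) (r : 'I_L -> nat) (M : R) :
  hausdorff_space G -> locally_compact [set: G] -> @second_countable G ->
  (forall t, 0 < t -> Phi (2 * t) <= M * Phi t) ->
  (forall K, compact K -> (0 < lambda K)%E -> forall e, 0 < e ->
     small_ratios lambda a (oweight w) (opower r) K 1 e) ->
  joint_approximation lambda Phi a w r.
Proof.
move=> hG lG sG D2 small f e e0.
have [K [cK mK exK]] := sigma_compact lG sG.
(* The Haar measure is nonzero and inner regular on the whole group. Adjoining [K0] to the compact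
   set used below makes its measure positive. *)
have [K0 cK0 K00] : exists2 K0, compact K0 & (0 < lambda K0)%E.
  apply: contrapT => nK; have [/eqP + _ _ /(_ setT openT) H _] := haar_measureP lambda; apply.
  apply/eqP; rewrite -measure_le0 [leLHS]H; apply: ge_ereal_sup => _ [K0 [cK0 _] <-].
  by rewrite leNgt; apply/negP => K00; apply: nK; exists K0.
pose A i m : set G := K m `&` [set x | normc (f i x) <= m%:R].
have mA i m : measurable (A i m : set (borel G)).
  apply: measurableI; first exact: compact_borel.
  have mf : measurable_fun [set: borel G] (EFin \o (fun x => normc (f i x))).
    by apply/measurable_EFinP; apply: measurable_normc; exact: (orlicz_funP (f i)).1.
  have := emeasurable_fun_infty_c measurableT mf m%:R%:E; rewrite setTI.
  by under eq_set do rewrite /= lee_fin.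
have Ax i x : \forall m \near \oo, A i m x.
  have [m Kx] := exK x; near=> k; split.
    by apply: mK Kx; near: k; exact: nbhs_infty_ge.
  rewrite /= (le_trans (ltW (archi_boundP (normc_ge0 _))))// ler_nat.
  by near: k; exact: nbhs_infty_ge.
have e4 : 0 < e / 4 by rewrite divr_gt0.
have e2 : 0 < e / 2 by rewrite divr_gt0.
have near_f : \forall m \near \oo, forall i,
    luxemburg lambda Phi (trim (A i m) (f i) - f i) <= e / 4.
  apply: filter_forall => i.
  exact: (luxemburg_trim_cvg D2 (mA i) (Ax i) (orlicz_funP (f i)) e4).
have [m fm] : exists m, forall i, luxemburg lambda Phi (trim (A i m) (f i) - f i) <= e / 4.
  by near \oo => m; exists m; near: m; exact: near_f.
have cKm : compact (K m `|` K0) by exact: compactU.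
have Km0 : (0 < lambda (K m `|` K0))%E.
  apply: lt_le_trans K00 _; apply: le_measure; rewrite ?inE; last exact: subsetUr.
    exact: compact_borel.
  exact: compact_borel.
have mh i : measurable_fun [set: borel G] (trim (A i m) (f i) : borel G -> borel R[i]^o).
  by apply: measurable_trim => //; exact: (orlicz_funP (f i)).1.
have hB i x : normc (trim (A i m) (f i) x) <= m%:R.
  have [Aix|nA] := pselect (A i m x); first by rewrite trim_in//; exact: Aix.2.
  by rewrite trim_out// normc0 ler0n.
have h0 i x : ~ (K m `|` K0) x -> trim (A i m) (f i) x = 0.
  by move=> nK; rewrite trim_out// => -[Kx _]; apply: nK; left.
have [n n1 [v Lv vh]] := bounded_approximation Phi hG cKm (ler0n _ _) e2 mh hB h0 (small _ cKm Km0).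
exists n => //; exists (OrliczFun (introT (orlicz_predP _ _ _) Lv)) => i.
have [g _ gE] := iter_oop a w r n i (OrliczFun (introT (orlicz_predP _ _ _) Lv)).
have Lg : is_orlicz lambda Phi (shift_mul a (oweight w i) (opower r i * n) v).
  by rewrite -[shift_mul _ _ _ _]gE; exact: orlicz_funP.
have Lh : is_orlicz lambda Phi (trim (A i m) (f i)).
  by apply: is_orlicz_trim => //; exact: orlicz_funP.
have LN (p : G -> R[i]^o) : is_orlicz lambda Phi p -> is_orlicz lambda Phi (- p).
  by move=> /(is_orliczZ (-1)); rewrite scaleN1r.
rewrite -(subrKA (trim (A i m) (f i))).
apply: (@le_lt_trans _ _ (e / 2 + e / 4)); last by lra.
apply: le_trans (luxemburgD _ _) _.
- by apply: is_orliczD => //; exact: LN.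
- by apply: is_orliczD => //; apply: LN; exact: orlicz_funP.
- by apply: lerD; [exact: vh|exact: fm].
Unshelve. all: by end_near. Qed.

Lemma measure_bigsetU_le d (T : measurableType d) (R : realType)
    (mu : {measure set T -> \bar R}) (I : Type) (s : seq I) (A : I -> set T) :
  (forall i, measurable (A i)) ->
  (mu (\big[setU/set0]_(i <- s) A i) <= \sum_(i <- s) mu (A i))%E.
Proof.
move=> mA; elim: s => [|i s IH]; first by rewrite !big_nil measure0.
rewrite !big_cons; apply: le_trans (measureU2 _ _ _) _ => //.
  by apply: bigsetU_measurable.
by rewrite leeD2l.
Qed.

(** * Transitivity implies small multipliers *)

Section necessity.
Local Open Scope complex_scope.
Context (G : topologicalGroupType) (R : realType).
Variables (lambda : right_haar_measure G R) (Phi : young_function R) (a : G).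
Variables (L : nat) (w : 'I_L -> weight G R) (r : 'I_L -> nat).
Hypothesis G_hausdorff : hausdorff_space G.
Local Notation C := (R[i]^o).
Local Notation W := (oweight w).
Local Notation rho := (opower r).

(** Right translation preserves the modular, so only the bound [c] of the cocycle enlarges the
    norm. *)
Lemma luxemburg_shift_mul (V : G -> R) n (f : G -> C) (c k : R) :
  (forall x, 0 <= V x) -> 0 < c -> (forall x, cocycle a V n x <= c) ->
  is_orlicz lambda Phi f -> is_orlicz lambda Phi (shift_mul a V n f) ->
  luxemburg lambda Phi f < k -> luxemburg lambda Phi (shift_mul a V n f) <= c * k.
Proof.
move=> V0 c0 Vc Lf LVf fk; have k0 : 0 < k by apply: le_lt_trans fk; exact: luxemburg_ge0.
apply: luxemburg_le; first exact: mulr_gt0.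
apply: le_trans (luxemburg_lt k0 Lf fk).
rewrite -[leRHS](haar_integral_rtranslation lambda (a ^- n)%g); last 2 first.
- by apply: measurable_young_normc; exact: Lf.1.
- by move=> x; rewrite lee_fin young_ge0.
apply: ge0_le_integral => //.
- by move=> x _; rewrite lee_fin young_ge0.
- by apply: measurable_young_normc; exact: LVf.1.
- apply: (@measurable_young_normc _ (borel G) _ Phi (fun x => f (x * a ^- n)%g) k^-1).
  exact: (measurableT_comp Lf.1 (measurable_rtranslation _)).
move=> x _; rewrite lee_fin /shift_mul normcM normc_real.
have m0 : 0 <= cocycle a V n x by rewrite prodr_ge0.
rewrite ger0_norm//; apply: young_le.
  by rewrite !mulr_ge0 ?normc_ge0// invr_ge0 mulr_ge0// ltW.
rewrite mulrA ler_wpM2r ?normc_ge0// mulrC invfM mulrA ler_piMl ?invr_ge0 ?(ltW k0)//.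
by rewrite ler_pdivrMr// mul1r.
Qed.

Lemma young_ge_near (A : R) : \forall t \near +oo%R, A <= Phi t.
Proof. by have /cvgryPge := young_cvgy Phi; apply. Qed.

Lemma joint_approximation_small (l0 : 'I_L) (K : set G) (N : nat) (e : R) :
  (forall l, 1 <= r l)%N -> injective r ->
  locally_compact [set: G] -> aperiodic a ->
  compact K -> (0 < lambda K)%E -> 0 < e ->
  joint_approximation lambda Phi a w r ->
  small_ratios lambda a W rho K N e.
Proof.
move=> r1 rI lG aa cK K0 e0 approx.
have mK := compact_borel G_hausdorff cK.
have Koo := haar_compact_lty lambda cK.
have [N1 escape] := aperiodic_escape G_hausdorff lG aa cK.
(* An exponent [n >= M] meets the demanded bound [N] and also separates [K] from its translates. *)
pose M := maxn N N1.
pose chi : G -> C := trim K (fun=> 1).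
have Lchi : is_orlicz lambda Phi chi.
  apply: (@is_orlicz_bounded _ _ _ lambda Phi chi K 1) => //.
  - by apply: measurable_trim => //; exact: measurable_complex_cst.
  - by move=> x Kx; rewrite /chi trim_in// normc1.
  - by move=> x nK; rewrite /chi trim_out.
have kappa0 : 0 < luxemburg lambda Phi chi.
  rewrite lt_neqAle luxemburg_ge0 andbT; apply/eqP => /esym /(luxemburg_eq0 Lchi).
  move=> [Z [mZ Z0 HZ]]; move: K0; apply/negP; rewrite -leNgt -Z0.
  apply: le_measure; rewrite ?inE// => x Kx; apply: HZ => /= /(_ I).
  by rewrite /chi trim_in// => /eqP; rewrite oner_eq0.
set kappa := luxemburg _ _ _ in kappa0.
pose S : R := #|{: option 'I_L * option 'I_L}|%:R.
have S0 : 0 < S by rewrite ltr0n card_prod card_option.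
(* [d] is the inverse of a large [t]: [t >= 1 + 1/e] yields [d / (1 - d) <= e], and [Phi t >= S / e]
   makes [S] exceptional sets of measure at most [1 / Phi t] fit within measure [e]. *)
have [d [d0 d1 de dP]] : exists d, [/\ 0 < d, d < 1, d <= e * (1 - d) & S * (Phi d^-1)^-1 <= e].
  have [t [t1 t2 t3]] : exists t : R, [/\ 1 < t, 1 + e^-1 <= t & S / e <= Phi t].
    near (+oo%R : set_system R) => t; exists t; split; near: t.
    - by apply: nbhs_pinfty_gt; rewrite num_real.
    - by apply: nbhs_pinfty_ge; rewrite num_real.
    - exact: young_ge_near.
  have t0 : 0 < t by rewrite (lt_trans _ t1).
  exists t^-1; split.
  - by rewrite invr_gt0.
  - by rewrite invf_lt1.
  - rewrite -(ler_pM2r t0) mulVf ?gt_eqF// -mulrA mulrBl mul1r mulVf ?gt_eqF//.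
    by rewrite -ler_pdivrMl// mulr1; lra.
  - rewrite invrK ler_pdivrMr ?young_gt0//.
    by rewrite -ler_pdivrMl// mulrC.
have [B wB] := weight_bounded (w l0).
pose c := Num.max 1 B ^+ (r l0 * M).
have c1 : 1 <= c by rewrite exprn_ege1// le_max lexx.
(* [c] bounds the norm of the [n]-th iterate for [n <= M]: no [v] near [chi] has
   its [n]-th iterate near [c0 *: chi]. *)
pose c0 := (c * (kappa + 1) + 1) / kappa + 1.
have c01 : 1 <= c0.
  rewrite lerDr; apply: divr_ge0; last exact: ltW.
  by rewrite ler_wpDr// mulr_ge0 ?(le_trans ler01 c1)// ler_wpDr// ltW.
pose target (i : option 'I_L) : R := if i is Some _ then c0 else 1.
have target1 i : 1 <= target i by case: i.
pose chiL : orlicz_fun lambda Phi := OrliczFun (introT (orlicz_predP _ _ _) Lchi).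
have dd0 : 0 < d * d by rewrite mulr_gt0.
have dd1 : d * d < 1 by rewrite mulr_ilt1// ltW.
have [n n1 [v vP]] := approx (fun i => (target i)%:C *: chiL) _ dd0.
have LT i : is_orlicz lambda Phi (shift_mul a (W i) (rho i * n) v).
  by have [g _ <-] := iter_oop a w r n i v; exact: orlicz_funP.
have LN (p : G -> C) : is_orlicz lambda Phi p -> is_orlicz lambda Phi (- p).
  by move=> /(is_orliczZ (-1)); rewrite scaleN1r.
have LD i : is_orlicz lambda Phi (shift_mul a (W i) (rho i * n) v - (target i)%:C *: chi).
  by apply: is_orliczD => //; apply: LN; exact: is_orliczZ.
have {}vP i : luxemburg lambda Phi (shift_mul a (W i) (rho i * n) v - (target i)%:C *: chi) < d * d.
  exact: vP.
have nM : (M <= n)%N.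
  rewrite leqNgt; apply/negP => nM.
  pose Tv : G -> C := shift_mul a (W (Some l0)) (rho (Some l0) * n) v.
  have Lv1 : luxemburg lambda Phi v < kappa + 1.
    have := vP None; rewrite (_ : shift_mul _ _ _ _ = v); last first.
      by apply/funext => x; rewrite /shift_mul cocycle_cst1 mul0n mul1r expg0 invg1 mulg1.
    rewrite scale1r => v1; rewrite -[X in luxemburg _ _ X](subrK chi).
    apply: le_lt_trans (luxemburgD _ Lchi) _.
      by apply: is_orliczD => //; [exact: orlicz_funP|exact: LN].
    by rewrite addrC ltrD2l; exact: lt_trans v1 dd1.
  have Tv1 : luxemburg lambda Phi Tv <= c * (kappa + 1).
    apply: (luxemburg_shift_mul _ _ _ _ (LT (Some l0)) Lv1).
    - by move=> x; exact/ltW/weight_gt0.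
    - exact: lt_le_trans c1.
    - move=> x; apply: (@le_trans _ _ (Num.max 1 B ^+ (r l0 * n))); last first.
        by rewrite ler_weXn2l ?le_max ?lexx// leq_mul2l ltnW ?orbT.
      rewrite -[X in _ ^+ X]subn0 -prodr_const_nat; apply: ler_prod => j _.
      by rewrite ltW ?weight_gt0//= le_max wB orbT.
    - exact: orlicz_funP.
  have : c0 * kappa <= c * (kappa + 1) + 1.
    rewrite -(ger0_norm (le_trans ler01 c01)) -normc_real -luxemburgZ//.
    rewrite -(subKr Tv (c0%:C *: chi)).
    apply: le_trans (luxemburgD _ (LN _ (LD (Some l0)))) _; first exact: LT.
    rewrite lerD// -[X in luxemburg _ _ X]scaleN1r luxemburgZ//.
    by rewrite normcN normc1 mul1r ltW// (lt_trans (vP (Some l0))).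
  rewrite /c0 mulrDl mulfVK ?gt_eqF// mul1r.
  by rewrite leNgt ltrDl kappa0.
pose D i : set G := [set x | d <= normc ((shift_mul a (W i) (rho i * n) v - (target i)%:C *: chi) x)].
have DP i : measurable (D i : set (borel G)) /\ (lambda (D i) <= ((Phi d^-1)^-1)%:E)%E.
  by apply: luxemburg_tail => //; exact: LD.
(* [X (i, j)] consists of the [y] whose translate [y a^((rho i - rho j) n)] falls in the exceptional
   set [D i]; in particular [X (j, j)] is [D j]. By invariance they all obey the bound for [D i]. *)
pose X (ij : option 'I_L * option 'I_L) : set G :=
  (fun y => y * a ^- (rho ij.2 * n))%g @^-1` ((fun y => y * a ^+ (rho ij.1 * n))%g @^-1` D ij.1).
have mX1 (ij : option 'I_L * option 'I_L) :
    measurable ((fun y : G => y * a ^+ (rho ij.1 * n))%g @^-1` D ij.1 : set (borel G)).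
  by rewrite -[X in measurable X]setTI; apply: measurable_rtranslation => //; exact: (DP _).1.
have mX ij : measurable (X ij : set (borel G)).
  by rewrite -[X in measurable X]setTI; exact: measurable_rtranslation.
have lX ij : (lambda (X ij) <= ((Phi d^-1)^-1)%:E)%E.
  by rewrite /X haar_rtranslation// haar_rtranslation; [exact: (DP _).2|exact: (DP _).1].
pose Y := \big[setU/set0]_(ij : option 'I_L * option 'I_L) X ij.
have mY : measurable (Y : set (borel G)) by exact: bigsetU_measurable.
have XY ij : X ij `<=` Y.
  by rewrite /Y (bigD1 ij)//=; exact: subsetUl.
have mE : measurable ((K `\` Y) : set (borel G)) by exact: measurableD.
exists n, (K `\` Y); split => //.
- by rewrite (leq_trans _ nM)// leq_maxl.
- apply: (@le_trans _ _ (lambda Y)).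
    apply: le_measure; rewrite ?inE//; first exact: measurableD.
    by move=> x [Kx nE]; apply: contrapT => nY; apply: nE.
  apply: le_trans (measure_bigsetU_le _ _ mX) _.
  apply: le_trans (lee_sum _ (fun ij _ => lX ij)) _.
  by rewrite sumEFin lee_fin sumr_const -mulr_natl.
move=> i j ij y [Ky nYy].
have rhoI : rho i != rho j.
  case: i j ij => [i|] [j|] //= ij.
  - by apply: contra ij => /eqP/rI ->.
  - by rewrite gtn_eqF// r1.
  - by rewrite ltn_eqF// r1.
have leN1 (p q : nat) : (p < q)%N -> (N1 <= q * n - p * n)%N.
  move=> pq; rewrite -mulnBl (leq_trans (leq_maxr N N1))// (leq_trans nM)//.
  by rewrite leq_pmull// subn_gt0.
pose z := (y * a ^- (rho j * n) * a ^+ (rho i * n))%g.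
(* [z] and [y] differ by a power of [a] with exponent at least [N1] in absolute value. When it is
   negative, [escape] is applied from [z], of which [y] is then a forward translate. *)
have nKz : ~ K z.
  have rho_lt p q : (p < q)%N -> (p * n <= q * n)%N by move=> /ltnW pq; rewrite leq_mul2r pq orbT.
  move: rhoI; rewrite neq_ltn => /orP[] lt.
    have ye : y = (z * a ^+ (rho j * n - rho i * n))%g.
      rewrite /z -{1}(subnKC (rho_lt _ _ lt)) -mulgA -expgnDr subnKC ?rho_lt//.
      by rewrite mulgVK.
    by move=> Kz; apply: (escape _ (leN1 _ _ lt) z Kz); rewrite -ye.
  have -> : z = (y * a ^+ (rho i * n - rho j * n))%g.
    by rewrite /z -{1}(subnKC (rho_lt _ _ lt)) expgnDr mulgA mulgVK.
  exact: (escape _ (leN1 _ _ lt) y Ky).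
(* [A_i^n v] at [z] and [A_j^n v] at [y] evaluate [v] at this same point. Hence [u] cancels, and
   [mi / mj] is below [d / (1 - d)]. *)
pose u := normc (v (y * a ^- (rho j * n))%g).
pose mi := cocycle a (W i) (rho i * n) z.
pose mj := cocycle a (W j) (rho j * n) y.
have mi0 : 0 < mi by apply: cocycle_gt0; exact: oweight_gt0.
have mj0 : 0 < mj by apply: cocycle_gt0; exact: oweight_gt0.
have hi : mi * u < d.
  have : ~ D i z by move=> Dz; apply: nYy; apply: (XY (i, j)).
  rewrite /D /= => /negP; rewrite -ltNge.
  rewrite -[X in normc X]/(shift_mul a (W i) (rho i * n) v z - (target i)%:C * chi z).
  rewrite /chi trim_out// mulr0 subr0 /shift_mul normcM normc_real gtr0_norm//.
  by rewrite /z mulgK.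
have hj : 1 - d < mj * u.
  have : ~ D j y.
    by move=> Dy; apply: nYy; apply: (XY (j, j)); rewrite /X /= mulgVK.
  rewrite /D /= => /negP; rewrite -ltNge.
  rewrite -[X in normc X]/(shift_mul a (W j) (rho j * n) v y - (target j)%:C * chi y).
  rewrite /chi trim_in// mulr1 => Dy.
  have : target j < mj * u + d; last by have := target1 j; lra.
  have t0 : 0 <= target j by rewrite (le_trans ler01).
  rewrite -[ltLHS](ger0_norm t0) -normc_real.
  rewrite -(subKr (shift_mul a (W j) (rho j * n) v y) (target j)%:C).
  apply: le_lt_trans (le_normcD _ _) _; apply: ler_ltD; last by rewrite normcN.
  by rewrite /shift_mul normcM normc_real gtr0_norm.
have u0 : 0 < u.
  by rewrite -(pmulr_rgt0 _ mj0) (lt_trans _ hj)// subr_gt0.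
rewrite /shift_ratio -/z -/mi -/mj ler_pdivrMr// -(ler_pM2r u0) -mulrA.
rewrite (le_trans (ltW hi))// (le_trans de)// ler_wpM2l ?ltW//.
Unshelve. all: by end_near. Qed.

End necessity.

(** * Equivalence of transitivity and small multipliers *)

Lemma aperiodic_noncompact (G : topologicalGroupType) (a : G) :
  aperiodic a -> ~ compact [set: G].
Proof.
move=> aa cG; apply: aa; apply: (subclosed_compact _ cG) => //.
by apply: closed_bigI => A [[_ cA] _].
Qed.

Theorem theorem2p2 (R : realType) (G : topologicalGroupType)
    (G_hausdorff : hausdorff_space G)
    (G_locally_compact : locally_compact [set: G])
    (G_second_countable : @second_countable G)
    (lambda : right_haar_measure G R)
    (a : G) (a_aperiodic : aperiodic a)
    (Phi : young_function R) (Phi_delta2 : delta2_regular G Phi)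
    (L : nat) (L_ge2 : (2 <= L)%N)
    (w : 'I_L -> weight G R)
    (w_inv : forall l, (fun x => (w l x)^-1) \in Lfun lambda +oo%E)
    (r : 'I_L -> nat) (r_ge1 : forall l, (1 <= r l)%N)
    (r_increasing : forall s l : 'I_L, (s < l)%N -> (r s < r l)%N) :
  let phi l n := varphi a (w l) n in
  let phit l n := varphit a (w l) n in
  disjoint_topologically_transitive
    (fun l : 'I_L => iter (r l) (weighted_translation lambda Phi a (w l)))
  <->
  (forall K : set G, compact K -> (0 < lambda K)%E ->
    exists (E : nat -> set (borel G)) (n : nat -> nat),
      [/\ forall k, measurable (E k) /\ E k `<=` K,
          lambda (E k) @[k --> \oo] --> lambda K,
          forall k, (1 <= n k)%N,
          forall i j, (i < j)%N -> (n i < n j)%N &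
          (forall l : 'I_L,
            ess_norm_on lambda (E k) (phi l (r l * n k)%N)
              @[k --> \oo] --> 0%E /\
            ess_norm_on lambda (E k) (phit l (r l * n k)%N)
              @[k --> \oo] --> 0%E) /\
          (forall s l : 'I_L, (s < l)%N ->
            ess_norm_on lambda (E k)
              (fun x => phit s ((r l - r s) * n k)%N x * phit l (r l * n k)%N x
                        / phit s (r l * n k)%N x)
              @[k --> \oo] --> 0%E /\
            ess_norm_on lambda (E k)
              (fun x => phi l ((r l - r s) * n k)%N x * phit s (r s * n k)%N x
                        / phit l (r s * n k)%N x)
              @[k --> \oo] --> 0%E)]).
Proof.
move=> phi phit.
(* An aperiodic element forces [G] to be noncompact, so the doubling condition holds for all
   [t > 0]. *)
have [M D2] : exists M, forall t, 0 < t -> Phi (2 * t) <= M * Phi t.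
  have [M [t0 [_ _ _ D2]]] := Phi_delta2.
  by exists M; apply: D2; exact: aperiodic_noncompact a_aperiodic.
have r_inj : injective r.
  move=> s l rsl; apply: val_inj; case: (ltngtP s l) => // /r_increasing;
    by rewrite rsl ltnn.
have W0 := oweight_gt0 w.
have pairs (E : nat -> set (borel G)) (n : nat -> nat) := shift_ratio_cvg_iff w a
  (fun F => ess_norm_on lambda (E k) (F k) @[k --> \oo] --> 0%E) n r_increasing.
split=> [/disjoint_transitiveP approx K cK K0|H].
  (* Stages with arbitrarily large exponents are needed here to build an increasing sequence; the
     converse extracts just one stage. *)
  have [|E [n [EK EcK n1 n_incr ratio0]]] := @small_ratios_cvg0 _ _ lambda a _ _ (opower r) W0 G_hausdorff K cK.
    move=> N e e0; apply: joint_approximation_small approx => //.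
    exact: (Ordinal (ltnW L_ge2)).
  by exists E, n; split => //; apply/pairs.
apply/disjoint_transitiveP; apply: small_ratios_approximation D2 _ => // K cK K0 e e0.
apply: ratios_cvg0_small => //.
have [E [n [EK EcK n1 n_incr /pairs ratio0]]] := H K cK K0.
by exists E, n; split.
Qed.
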